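(* Let $m\ge 1$ be an integer and let $n=2m$ or $n=2m+1$. Let $t_0\in\mathbb{R}$ be such that $a(t)^kX_2\subset X_1$ for all $t\in\mathbb{C}$ with $|t|>t_0$ and all $k\in\mathbb{Z}$, $k\neq 0$, and let $s_0=2$. Let $t,s\in\mathbb{C}$ satisfy $|t|>t_0$ and $|s|>s_0$, and let $H_n(t,s)=\langle a(t),b(s)\rangle$. If $n=2m$, then $H_{2m}(t,s)$ is a free group of rank $2$ which is a Zariski-dense subgroup of $\mathrm{Sp}(2m,\mathbb{C})$. If $n=2m+1$, then $H_{2m+1}(t,s)$ is a free group of rank $2$ which is a Zariski-dense subgroup of $\mathrm{SL}(2m+1,\mathbb{C})$.
   Context: $e_{i,j}$ denotes the $n\times n$ matrix with a $1$ in position $(i,j)$ and zeros elsewhere, and $1_n$ is the identity matrix. Put $x=\sum_{i=1}^{n-1}e_{i,i+1}$ and $y=e_{n,1}$. For $t,s\in\mathbb{C}$ let $a(t)=\exp(tx)=1_n+\sum_{i<j}\frac{t^{j-i}}{(j-i)!}e_{i,j}$ and $b(s)=\exp(sy)=1_n+se_{n,1}$. These act on $\mathbb{C}^n$ from the left (vectors regarded as columns). Let $X_1=\{(x_1,\ldots,x_n)\in\mathbb{C}^n : |x_1|>|x_i|,\ 2\le i\le n\}$ and $X_2=\{(x_1,\ldots,x_n)\in\mathbb{C}^n : |x_n|>|x_i|,\ 1\le i\le n-1\}$. For each $n$ a number $t_0$ (depending on $n$) with the property required in the claim exists. For $n=2m$ even, $\mathrm{Sp}(n,\mathbb{C})$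 is realized as $\{g\in\mathrm{GL}(n,\mathbb{C}) : gJg^{T}=J\}$, where $J=\sum_{i=1}^n(-1)^ie_{i,n+1-i}$ (a nondegenerate skew-symmetric matrix); its Lie algebra is the set of $z\in\mathfrak{sl}(n,\mathbb{C})$ fixed by the linear map $\varphi(e_{i,j})=(-1)^{i-j+1}e_{n-j+1,n-i+1}$. *)

(* Defs.v *)
From mathcomp Require Import all_boot all_order all_algebra.
From mathcomp Require Import boolp classical_sets reals.
From mathcomp Require Import complex.
From mathcomp Require mpoly.

Set Implicit Arguments.
Unset Strict Implicit.
Unset Printing Implicit Defensive.

Import Order.TTheory GRing.Theory Num.Theory.

Local Open Scope classical_set_scope.
Local Open Scope ring_scope.

(** Indices are 0-based: the position (i, j) of the mathematical text is
    (i - 1, j - 1) here. The dimension n is an arbitrary natural number, so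
    that n = 2m and n = 2m + 1 need no casts. *)

Definition nilp_x (C : pzRingType) (n : nat) : 'M[C]_n :=
  \sum_(i < n) \sum_(j < n | j == i.+1 :> nat) delta_mx i j.

Definition nilp_y (C : pzRingType) (n : nat) : 'M[C]_n :=
  \sum_(i < n | i.+1 == n) \sum_(j < n | j == 0 :> nat) delta_mx i j.

(** a(t) = exp(t x) and b(s) = exp(s y) in closed form; see [mat_aE] and
    [mat_bE] for the exponential series. *)
Definition mat_a (C : fieldType) (n : nat) (t : C) : 'M[C]_n :=
  1%:M + \sum_(i < n) \sum_(j < n | (i < j)%N)
           (t ^+ (j - i) / ((j - i)`!)%:R) *: delta_mx i j.

Definition mat_b (C : pzRingType) (n : nat) (s : C) : 'M[C]_n :=
  1%:M + s *: nilp_y C n.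

Definition mxexp_partial (C : fieldType) (n : nat) (A : 'M[C]_n) (N : nat) :
  'M[C]_n := \sum_(k < N) (k`!)%:R^-1 *: A ^+ k.

Lemma sum_delta (C : pzRingType) (n : nat) (P : nat -> nat -> bool)
    (f : nat -> nat -> C) (i j : 'I_n) :
  (\sum_(k < n) \sum_(l < n | P k l) f k l *: delta_mx k l : 'M[C]_n) i j =
  if P i j then f i j else 0.
Proof.
rewrite summxE (bigD1 i) //= [X in _ + X]big1 ?addr0; last first.
  move=> k ki; rewrite summxE big1 // => l _.
  by rewrite !mxE eq_sym (negbTE ki) /= mulr0.
rewrite summxE; case: ifP => Pij; last first.
  rewrite big1 // => l Pl; rewrite !mxE eqxx /=.
  by case: eqP => [jl|_]; [rewrite -jl Pij in Pl | rewrite mulr0].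
rewrite (bigD1 j) //= big1 ?addr0; last first.
  by move=> l /andP[_ lj]; rewrite !mxE eqxx /= eq_sym (negbTE lj) mulr0.
by rewrite !mxE !eqxx mulr1.
Qed.

Lemma nilp_xE (C : pzRingType) (n : nat) (i j : 'I_n) :
  nilp_x C n i j = (j == i.+1 :> nat)%:R.
Proof.
rewrite /nilp_x.
under eq_bigr do under eq_bigr do rewrite -[delta_mx _ _]scale1r.
rewrite (sum_delta (fun i j => j == i.+1) (fun _ _ => 1)).
by case: ifP.
Qed.

Lemma nilp_x_expE (C : pzRingType) (n k : nat) (i j : 'I_n) :
  (nilp_x C n ^+ k) i j = (j == (i + k)%N :> nat)%:R.
Proof.
elim: k i j => [|k IH] i j.
  by rewrite expr0 addn0 mxE eq_sym.
rewrite exprSr mxE.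
under eq_bigr do rewrite IH nilp_xE -natrM mulnb.
have [lt|ge] := ltnP (i + k)%N n; last first.
  rewrite big1; last first.
    move=> l _; case: eqP => //= E.
    by have := ltn_ord l; rewrite E ltnNge ge.
  case: eqP => // E.
  by have := ltn_ord j; rewrite E addnS ltnNge (leq_trans ge).
rewrite (bigD1 (Ordinal lt)) //= eqxx big1 ?addr0 ?addnS // => l ne.
by case: eqP => //= E; case/eqP: ne; apply: val_inj.
Qed.

Lemma mat_aE (C : numFieldType) (n N : nat) (t : C) : (n <= N)%N ->
  mxexp_partial (t *: nilp_x C n) N = mat_a n t.
Proof.
move=> nN; apply/matrixP=> i j.
rewrite /mat_a mxE.
rewrite (sum_delta (fun i j => i < j)%N
  (fun i j => t ^+ (j - i) / ((j - i)`!)%:R)) mxE /mxexp_partial summxE.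
have E k : (t *: nilp_x C n) ^+ k = t ^+ k *: nilp_x C n ^+ k.
  elim: k => [|k IH]; first by rewrite !expr0 scale1r.
  by rewrite !exprSr IH -!mulmxE -scalemxAl -scalemxAr scalerA.
have F (k : nat) : (k`!%:R^-1 *: (t *: nilp_x C n) ^+ k) i j =
    k`!%:R^-1 * t ^+ k * (j == (i + k)%N :> nat)%:R.
  by rewrite E !mxE nilp_x_expE mulrA.
under eq_bigr do rewrite F.
have [ji|ij] := ltnP j i.
  rewrite big1; first by rewrite ltnNge ltnW //= -val_eqE gtn_eqF // addr0.
  by move=> k _; rewrite ltn_eqF ?mulr0 // (leq_trans ji) ?leq_addr.
have jiN : (j - i < N)%N by rewrite (leq_ltn_trans (leq_subr _ _)) // (leq_trans _ nN).
rewrite (bigD1 (Ordinal jiN)) //= subnKC // eqxx mulr1 big1 ?addr0; last first.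
  move=> k ne; case: eqP => [E'|_]; last by rewrite mulr0.
  by case/eqP: ne; apply: val_inj; rewrite /= E' addKn.
rewrite ltn_neqAle ij andbT -val_eqE.
have [e|ne] := eqVneq (i : nat) j; last by rewrite mulrC add0r.
by rewrite /= -e subnn fact0 invr1 expr0 mulr1 addr0.
Qed.

Lemma nilp_yE (C : pzRingType) (n : nat) (i j : 'I_n) :
  nilp_y C n i j = ((i.+1 == n) && (j == 0 :> nat))%:R.
Proof.
rewrite /nilp_y big_mkcond /=.
have -> : \sum_(i0 < n) (if i0.+1 == n then
     \sum_(j0 < n | j0 == 0 :> nat) delta_mx i0 j0 else 0) =
   \sum_(i0 < n) \sum_(j0 < n | (i0.+1 == n) && (j0 == 0 :> nat))
      1 *: delta_mx i0 j0 :> 'M[C]_n.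
  apply: eq_bigr => k _; case: ifP => _ /=; last by rewrite big_pred0.
  by apply: eq_bigr => l _; rewrite scale1r.
rewrite (sum_delta (fun i j => (i.+1 == n) && (j == 0)) (fun _ _ => 1)).
by case: ifP.
Qed.

Lemma mat_bE (C : numFieldType) (n N : nat) (s : C) : (1 < n)%N -> (1 < N)%N ->
  mxexp_partial (s *: nilp_y C n) N = mat_b n s.
Proof.
move=> n1; case: N => [|[|N]] // _.
have sq : (s *: nilp_y C n) ^+ 2 = 0.
  apply/matrixP=> i j; rewrite expr2 !mxE big1 // => k _.
  rewrite !mxE !nilp_yE.
  have [k0|kn0] := eqVneq (k : nat) 0%N.
    by rewrite k0 (ltn_eqF n1) /= !mulr0.
  by rewrite andbF mulr0 mul0r.
rewrite /mxexp_partial !big_ord_recl /= expr0 fact0 invr1 scale1r big1.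
  rewrite addr0 /mat_b; congr (_ + _).
  by rewrite -[LHS]/(1 *: (s *: nilp_y C n) ^+ 1) expr1 scale1r.
move=> k _; rewrite -[bump 0 (bump 0 k)]/(2 + k)%N.
by rewrite exprD sq mul0r scaler0.
Qed.

(** For invertible [A]; ['M_n] is not a [unitRingType] when n is a variable,
    which is why [exprz] does not apply. *)
Definition mxpowz (C : comUnitRingType) (n : nat) (A : 'M[C]_n) (k : int) :
    'M[C]_n :=
  match k with
  | Posz p => A ^+ p
  | Negz p => invmx (A ^+ p.+1)
  end.

(** The first coordinate is the one with [i = 0], the last the one with
    [i.+1 = n]. *)
Definition X1 (C : numDomainType) (n : nat) : set 'cV[C]_n :=
  [set v | forall i j : 'I_n, i = 0 :> nat -> j <> i -> `|v j 0| < `|v i 0|].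

Definition X2 (C : numDomainType) (n : nat) : set 'cV[C]_n :=
  [set v | forall i j : 'I_n, i.+1 = n -> j <> i -> `|v j 0| < `|v i 0|].

Definition mxgroup (C : comUnitRingType) (n : nat) (H : set 'M[C]_n) : Prop :=
  [/\ forall A, H A -> A \in unitmx,
      H 1%:M,
      forall A B, H A -> H B -> H (A *m B) &
      forall A, H A -> H (invmx A)].

Definition mxgen (C : comUnitRingType) (n : nat) (S : set 'M[C]_n) :
  set 'M[C]_n := smallest (@mxgroup C n) S.

(** Words in the letters e_i (sign [true]) and e_i^-1 (sign [false]). *)
Definition reduced_word (r : nat) (w : seq ('I_r * bool)) : bool :=
  sorted (fun x y => ~~ ((x.1 == y.1) && (x.2 != y.2))) w.

Definition eval_word (C : comUnitRingType) (n r : nat) (e : 'I_r -> 'M[C]_n)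
    (w : seq ('I_r * bool)) : 'M[C]_n :=
  \prod_(x <- w) (if x.2 then e x.1 else invmx (e x.1)).

(** H is free on some family e_0, ..., e_(r-1) of its elements: each element of
    H is the value of exactly one reduced word. *)
Definition free_of_rank (C : comUnitRingType) (n r : nat) (H : set 'M[C]_n) :
    Prop :=
  mxgroup H /\
  exists e : 'I_r -> 'M[C]_n,
    (forall i, H (e i)) /\
    (forall A, H A -> exists! w, reduced_word w /\ eval_word e w = A).

(** Polynomial functions of the n^2 matrix entries. *)
Definition mxeval (C : comNzRingType) (n : nat)
    (p : mpoly.mpoly (n * n) C) (A : 'M[C]_n) : C :=
  mpoly.meval (fun k => mxvec A 0 k) p.

Definition zariski_closed (C : comNzRingType) (n : nat) (Z : set 'M[C]_n) :
    Prop :=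
  exists S : set (mpoly.mpoly (n * n) C),
    Z = [set A | forall p, S p -> mxeval p A = 0].

Definition zariski_closure (C : comNzRingType) (n : nat) (Z : set 'M[C]_n) :
  set 'M[C]_n := smallest (@zariski_closed C n) Z.

(** Density for the topology induced on G; no need for G to be closed. *)
Definition zariski_dense_subgroup (C : fieldType) (n : nat)
    (H G : set 'M[C]_n) : Prop :=
  [/\ mxgroup H, H `<=` G & G `<=` zariski_closure H].

Definition SLmx (C : comUnitRingType) (n : nat) : set 'M[C]_n :=
  [set g | \det g = 1].

(** [i.+1] because of the 0-based indices. *)
Definition symp_J (C : pzRingType) (n : nat) : 'M[C]_n :=
  \sum_(i < n) (-1) ^+ i.+1 *: delta_mx i (rev_ord i).

Definition Spmx (C : comUnitRingType) (n : nat) : set 'M[C]_n :=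
  [set g | g \in unitmx /\ g *m symp_J C n *m g^T = symp_J C n].

Definition H_group (C : fieldType) (n : nat) (t s : C) : set 'M[C]_n :=
  mxgen [set mat_a n t; mat_b n s].

Arguments X1 C n : clear implicits.
Arguments X2 C n : clear implicits.
Arguments SLmx C n : clear implicits.
Arguments Spmx C n : clear implicits.
Arguments H_group {C} n t s.

(* Main.v *)
(** The group is free by ping-pong on [X1] and [X2].

    For density, let [K] ([zstab]) be the closed monoid of matrices whose right
    multiplication preserves the Zariski closure of [H]. Since [a(t)^k = a(k t)]
    is polynomial in [k], [K] contains [a(u)] and [b(u)] for all [u], hence all
    the transvections [a(u) b(c) a(-u) = 1 + c nu(u) nud(u)], where
    [nu(u) = a(u) e_n] runs along the moment curve and [nud(u) = e_1^T a(-u)].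
    The pairing of [nud(u)] with [nu(w)] is [(w - u)^(n-1) / (n-1)!], and [nu]
    spans the space.

    For [n] even this pairing is alternating: it is the restriction to the
    curve of the symplectic form [J]. Conjugating transvections by one another
    then produces all the symplectic transvections, which generate [Sp].

    For [n] odd the pairing is symmetric, and conjugating with three points of
    the curve yields all transvections with a given direction [nu(u)], then all
    transvections, which generate [SL]. *)

Require Import Defs.
From mathcomp Require Import all_boot all_order all_algebra.
From mathcomp Require Import boolp classical_sets reals.
From mathcomp Require Import complex ring zify.

Set Implicit Arguments.
Unset Strict Implicit.
Unset Printing Implicit Defensive.

Import Order.TTheory GRing.Theory Num.Theory.

Local Open Scope classical_set_scope.
Local Open Scope ring_scope.

(** * Zariski closure and one-parameter subgroups *)

Lemma mat_aij (F : fieldType) n (u : F) (i j : 'I_n) :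
  mat_a n u i j = if (i <= j)%N then u ^+ (j - i) / (j - i)`!%:R else 0.
Proof.
rewrite /mat_a mxE (sum_delta (fun i j => i < j)%N
  (fun i j => u ^+ (j - i) / (j - i)`!%:R)) mxE ltn_neqAle -val_eqE.
have [->|_] /= := eqVneq (i : nat) j; last by rewrite add0r.
by rewrite leqnn subnn expr0 fact0 divr1 addr0.
Qed.

Lemma mat_a0 (F : fieldType) n : mat_a n (0 : F) = 1%:M.
Proof.
apply/matrixP => i j; rewrite mat_aij mxE -val_eqE expr0n subn_eq0.
by case: ltngtP => // [|->]; rewrite ?mul0r // subnn divr1.
Qed.

(** Only the indices [k] with [i <= k <= j] contribute to the entry [(i, j)]; shifted by [i], they
    give the binomial expansion of [(u + v) ^+ (j - i)] divided by [(j - i)!]. *)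
Lemma mat_aD (F : numFieldType) n (u v : F) :
  mat_a n u *m mat_a n v = mat_a n (u + v).
Proof.
apply/matrixP => i j; rewrite mxE mat_aij.
under eq_bigr do rewrite !mat_aij.
pose f k := (if (i <= k)%N then u ^+ (k - i) / (k - i)`!%:R else 0) *
  (if (k <= j)%N then v ^+ (j - k) / (j - k)`!%:R else 0) : F.
rewrite -/(\sum_(k < n) f k) -(big_mkord xpredT f) /f.
case: leqP => [ij|ji]; last first.
  apply: big1 => k _; case: leqP => ik; last by rewrite mul0r.
  by rewrite leqNgt (leq_trans ji ik) mulr0.
rewrite (big_cat_nat (n := i)) //= ?(ltnW (ltn_ord i)) //.
rewrite big_nat_cond big1 ?add0r; last first.
  by move=> k; rewrite andbT => /andP[_ ki]; rewrite leqNgt ki mul0r.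
rewrite (big_cat_nat (n := j.+1)) //= ?(leq_trans ij) // [X in _ + X]big_nat_cond.
rewrite [X in _ + X]big1 ?addr0; last first.
  by move=> k; rewrite andbT => /andP[jk _]; rewrite [(k <= j)%N]leqNgt jk mulr0.
rewrite -{1}[i : nat]add0n big_addn subSn // big_mkord.
rewrite [u + v]addrC exprDn mulr_suml; apply: eq_bigr => k _.
have kj : (k <= j - i)%N by rewrite -ltnS.
have kij : (k + i <= j)%N by rewrite addnC -leq_subRL.
rewrite leq_addl addnK kij addnC subnDA -(bin_fact kj) !natrM -mulr_natr.
field; rewrite !pnatr_eq0 -!lt0n !fact_gt0 bin_gt0 kj.
done.
Qed.

(** An inductive predicate, so that stability under translation and restriction to curves follow by
    induction; [polyfun_mxeval] links it to [mxeval]. *)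
Inductive polyfun (F : comNzRingType) n : ('M[F]_n -> F) -> Prop :=
| Polyfun_const c : polyfun (fun _ => c)
| Polyfun_coef i j : polyfun (fun A => A i j)
| Polyfun_add f g : polyfun f -> polyfun g -> polyfun (fun A => f A + g A)
| Polyfun_mul f g : polyfun f -> polyfun g -> polyfun (fun A => f A * g A).

Lemma polyfun_sum (F : comNzRingType) n I (r : seq I)
    (f : I -> 'M[F]_n -> F) :
  (forall i, polyfun (f i)) -> polyfun (fun A => \sum_(i <- r) f i A).
Proof.
move=> fP; elim: r => [|i r IH].
  by under eq_fun do rewrite big_nil; apply: Polyfun_const.
by under eq_fun do rewrite big_cons; apply: Polyfun_add.
Qed.

Lemma polyfun_prod (F : comNzRingType) n I (r : seq I)
    (f : I -> 'M[F]_n -> F) :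
  (forall i, polyfun (f i)) -> polyfun (fun A => \prod_(i <- r) f i A).
Proof.
move=> fP; elim: r => [|i r IH].
  by under eq_fun do rewrite big_nil; apply: Polyfun_const.
by under eq_fun do rewrite big_cons; apply: Polyfun_mul.
Qed.

Lemma polyfun_exp (F : comNzRingType) n (f : 'M[F]_n -> F) k :
  polyfun f -> polyfun (fun A => f A ^+ k).
Proof.
move=> fP; elim: k => [|k IH].
  by under eq_fun do rewrite expr0; apply: Polyfun_const.
by under eq_fun do rewrite exprS; apply: Polyfun_mul.
Qed.

Lemma polyfun_mxeval (F : comNzRingType) n (p : mpoly.mpoly (n * n) F) :
  polyfun (mxeval p).
Proof.
rewrite /mxeval /mpoly.meval /mpoly.mmap.
apply: polyfun_sum => k; apply: Polyfun_mul; first exact: Polyfun_const.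
rewrite /mpoly.mmap1; apply: polyfun_prod => i.
apply: polyfun_exp; case/mxvec_indexP: i => i j.
under eq_fun do rewrite mxvecE.
exact: Polyfun_coef.
Qed.

Lemma polyfun_mulmxr (F : comNzRingType) n (f : 'M[F]_n -> F) (B : 'M_n) :
  polyfun f -> polyfun (fun A => f (A *m B)).
Proof.
elim=> [c|i j|g h _ IHg _ IHh|g h _ IHg _ IHh].
- exact: Polyfun_const.
- under eq_fun do rewrite mxE.
  apply: polyfun_sum => k.
  by apply: Polyfun_mul; [exact: Polyfun_coef | exact: Polyfun_const].
- exact: Polyfun_add.
- exact: Polyfun_mul.
Qed.

(** Reduces vanishing along a curve with polynomial entries to a root count in one variable. *)
Lemma polyfun_curve (F : comNzRingType) n (f : 'M[F]_n -> F)
    (G : 'M[{poly F}]_n) :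
  polyfun f -> exists q : {poly F}, forall u,
    f (\matrix_(i, j) (G i j).[u]) = q.[u].
Proof.
elim=> [c|i j|g h _ [q qE] _ [r rE]|g h _ [q qE] _ [r rE]].
- by exists c%:P => u; rewrite hornerC.
- by exists (G i j) => u; rewrite mxE.
- by exists (q + r) => u; rewrite hornerD -qE -rE.
- by exists (q * r) => u; rewrite hornerM -qE -rE.
Qed.

(** In characteristic zero the multiples of [t] are distinct, and [size q] of them are already too
    many roots for a nonzero [q]. *)
Lemma poly_natmul_roots (F : numFieldType) (q : {poly F}) (t : F) :
  t != 0 -> (forall k : nat, q.[t *+ k] = 0) -> q = 0.
Proof.
move=> t0 qt; apply/eqP; apply: contraT => q0.
have := @max_poly_roots _ q [seq t *+ k | k <- iota 0 (size q)] q0.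
rewrite size_map size_iota ltnn => -> //.
  by apply/allP => _ /mapP[k _ ->]; rewrite /root qt.
rewrite map_inj_uniq ?iota_uniq // => k l /eqP.
by rewrite -(mulr_natr t k) -(mulr_natr t l) (inj_eq (mulfI t0)) eqr_nat => /eqP.
Qed.

(** * The closure of a set of matrices and its stabilizer under right multiplication *)

Definition zclosure (F : comNzRingType) n (H : set 'M[F]_n) : set 'M[F]_n :=
  [set A | forall f, polyfun f -> (forall B, H B -> f B = 0) -> f A = 0].

Lemma zclosure_sub (F : comNzRingType) n (H : set 'M[F]_n) :
  zclosure H `<=` zariski_closure H.
Proof.
move=> A HA Z [[P ->] HZ] p Pp.
by apply: HA (polyfun_mxeval p) _ => B /HZ; exact.
Qed.

Definition zstab (F : comNzRingType) n (H : set 'M[F]_n) : set 'M[F]_n :=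
  [set A | forall B, zclosure H B -> zclosure H (B *m A)].

Lemma zstab1 (F : comNzRingType) n (H : set 'M[F]_n) : zstab H 1%:M.
Proof. by move=> B; rewrite mulmx1. Qed.

Lemma zstabM (F : comNzRingType) n (H : set 'M[F]_n) A B :
  zstab H A -> zstab H B -> zstab H (A *m B).
Proof. by move=> HA HB D /HA/HB; rewrite mulmxA. Qed.

(** For [B] in the closure and [f] vanishing on [H], the value of [f] at [B *m G(u)] is a polynomial
    in [u] with all the multiples of [t] as roots, hence zero. *)
Lemma zstab_curve (F : numFieldType) n (H : set 'M[F]_n) (G : 'M[{poly F}]_n)
    (t : F) : t != 0 ->
  (forall k : nat, zstab H (\matrix_(i, j) (G i j).[t *+ k])) ->
  forall u, zstab H (\matrix_(i, j) (G i j).[u]).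
Proof.
move=> t0 Ht u B HB f fP fH.
pose G' : 'M[{poly F}]_n := map_mx polyC B *m G.
have [q qE] := polyfun_curve G' fP.
have GE v : B *m (\matrix_(i, j) (G i j).[v]) = \matrix_(i, j) (G' i j).[v].
  apply/matrixP => i j; rewrite !mxE horner_sum; apply: eq_bigr => k _.
  by rewrite !mxE hornerM hornerC.
rewrite GE qE (poly_natmul_roots t0 _ (q := q)) ?horner0 // => k.
by rewrite -qE -GE; exact: Ht.
Qed.

(** Right translation by an element of [H] is polynomial and maps [H] into itself, so it maps the
    closure into itself. *)
Lemma sub_zstab (F : comNzRingType) n (H : set 'M[F]_n) :
  (forall A B, H A -> H B -> H (A *m B)) -> H `<=` zstab H.
Proof.
move=> HM A HA B HB f fP fH.
by apply: (HB _ (polyfun_mulmxr A fP)) => D HD; apply: fH; apply: HM.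
Qed.

Lemma zstab_sub (F : comNzRingType) n (H : set 'M[F]_n) :
  H 1%:M -> zstab H `<=` zariski_closure H.
Proof.
by move=> H1 A HA; apply: zclosure_sub; rewrite -[A]mul1mx; apply: HA => f _; exact.
Qed.

Lemma zstab_mat_a (F : numFieldType) n (H : set 'M[F]_n) (t u : F) : t != 0 ->
  (forall A B, H A -> H B -> H (A *m B)) -> H 1%:M -> H (mat_a n t) ->
  zstab H (mat_a n u).
Proof.
move=> t0 HM H1 Ha.
pose G : 'M[{poly F}]_n := \matrix_(i, j) if (i <= j)%N then
  (j - i)`!%:R^-1 *: 'X^(j - i) else 0.
have GE v : \matrix_(i, j) (G i j).[v] = mat_a n v.
  apply/matrixP => i j; rewrite mat_aij !mxE.
  by case: leqP; rewrite ?horner0 // hornerZ hornerXn mulrC.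
rewrite -GE; apply: zstab_curve t0 _ u => k; rewrite GE.
apply: sub_zstab => //; elim: k => [|k IH]; first by rewrite mulr0n mat_a0.
by rewrite mulrS -mat_aD; apply: HM.
Qed.

Lemma mat_bD (F : comNzRingType) n (u v : F) : (1 < n)%N ->
  mat_b n u *m mat_b n v = mat_b n (u + v).
Proof.
move=> n1; rewrite /mat_b mulmxDl !mulmxDr mulmx1 mul1mx mulmx1.
rewrite -scalemxAl -scalemxAr (_ : _ *m _ = 0) ?scaler0 ?addr0; last first.
  apply/matrixP => i j; rewrite mxE mxE big1 // => k _; rewrite !nilp_yE.
  have [->|] := eqVneq (k : nat) 0%N; last by rewrite andbF mul0r.
  by rewrite (ltn_eqF n1) mulr0.
by rewrite -addrA -scalerDl addrC [u + v]addrC addrC.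
Qed.

Lemma mat_b0 (F : comNzRingType) n : mat_b n (0 : F) = 1%:M.
Proof. by rewrite /mat_b scale0r addr0. Qed.

Lemma zstab_mat_b (F : numFieldType) n (H : set 'M[F]_n) (t u : F) :
  (1 < n)%N -> t != 0 ->
  (forall A B, H A -> H B -> H (A *m B)) -> H 1%:M -> H (mat_b n t) ->
  zstab H (mat_b n u).
Proof.
move=> n1 t0 HM H1 Hb.
pose G : 'M[{poly F}]_n := \matrix_(i, j)
  ((i == j)%:R + (nilp_y F n i j) *: 'X).
have GE v : \matrix_(i, j) (G i j).[v] = mat_b n v.
  apply/matrixP => i j; rewrite !mxE hornerD hornerZ hornerX.
  by rewrite -polyC_natr hornerC mulrC.
rewrite -GE; apply: zstab_curve t0 _ u => k; rewrite GE.
apply: sub_zstab => //; elim: k => [|k IH]; first by rewrite mulr0n mat_b0.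
by rewrite mulrS -mat_bD //; apply: HM.
Qed.

(** * Transvections and the moment curve *)

Section Pairing.
Variables (F : comNzRingType) (n : nat).
Implicit Types (v w : 'cV[F]_n) (phi psi : 'rV[F]_n).

Definition pairing phi v : F := (phi *m v) 0 0.
Definition transv v phi : 'M[F]_n := 1%:M + v *m phi.

Lemma pairingDl phi psi v : pairing (phi + psi) v = pairing phi v + pairing psi v.
Proof. by rewrite /pairing mulmxDl mxE. Qed.
Lemma pairingDr phi v w : pairing phi (v + w) = pairing phi v + pairing phi w.
Proof. by rewrite /pairing mulmxDr mxE. Qed.
Lemma pairingZl c phi v : pairing (c *: phi) v = c * pairing phi v.
Proof. by rewrite /pairing -scalemxAl mxE. Qed.
Lemma pairingZr c phi v : pairing phi (c *: v) = c * pairing phi v.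
Proof. by rewrite /pairing -scalemxAr mxE. Qed.
Lemma pairingNl phi v : pairing (- phi) v = - pairing phi v.
Proof. by rewrite -scaleN1r pairingZl mulN1r. Qed.
Lemma pairingNr phi v : pairing phi (- v) = - pairing phi v.
Proof. by rewrite -scaleN1r pairingZr mulN1r. Qed.
Lemma pairing0l v : pairing 0 v = 0.
Proof. by rewrite /pairing mul0mx mxE. Qed.
Lemma pairing0r phi : pairing phi 0 = 0.
Proof. by rewrite /pairing mulmx0 mxE. Qed.
Lemma pairing_mulmx phi A v : pairing (phi *m A) v = pairing phi (A *m v).
Proof. by rewrite /pairing mulmxA. Qed.

Definition pairingE := (pairingDl, pairingDr, pairingZl, pairingZr, pairingNl,
  pairingNr, pairing0l, pairing0r).

Lemma pairing_col phi v w : v *m phi *m w = pairing phi w *: v.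
Proof. by rewrite -mulmxA [phi *m w]mx11_scalar mul_mx_scalar. Qed.
Lemma pairing_row phi psi v : psi *m (v *m phi) = pairing psi v *: phi.
Proof. by rewrite mulmxA [psi *m v]mx11_scalar mul_scalar_mx. Qed.

Lemma transv_mulmx v phi w : transv v phi *m w = w + pairing phi w *: v.
Proof. by rewrite mulmxDl mul1mx pairing_col. Qed.
Lemma mulmx_transv v phi psi : psi *m transv v phi = psi + pairing psi v *: phi.
Proof. by rewrite mulmxDr mulmx1 pairing_row. Qed.

Lemma transv0l phi : transv 0 phi = 1%:M.
Proof. by rewrite /transv mul0mx addr0. Qed.
Lemma transv0r v : transv v 0 = 1%:M.
Proof. by rewrite /transv mulmx0 addr0. Qed.

(** The cross term of the product is [pairing phi w *: (v *m phi)], which vanishes. *)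
Lemma transvDl v w phi : pairing phi w = 0 ->
  transv v phi *m transv w phi = transv (v + w) phi.
Proof.
move=> pw; rewrite {2}/transv mulmxDr mulmx1 mulmxA transv_mulmx pw scale0r.
by rewrite addr0 /transv mulmxDl addrA.
Qed.

Lemma transvDr v phi psi : pairing phi v = 0 ->
  transv v phi *m transv v psi = transv v (phi + psi).
Proof.
move=> pw; rewrite {2}/transv mulmxDr mulmx1 mulmxA transv_mulmx pw scale0r.
by rewrite addr0 /transv mulmxDr addrA.
Qed.

Lemma transvK v phi : pairing phi v = 0 ->
  transv v phi *m transv (- v) phi = 1%:M.
Proof.
by move=> pv; rewrite transvDl ?pairingNr ?pv ?oppr0 // subrr transv0l.
Qed.

Lemma transvVK v phi : pairing phi v = 0 ->
  transv (- v) phi *m transv v phi = 1%:M.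
Proof. by move=> pv; rewrite transvDl // addNr transv0l. Qed.

Lemma transv_conj g h v phi : g *m h = 1%:M ->
  g *m transv v phi *m h = transv (g *m v) (phi *m h).
Proof. by move=> gh; rewrite /transv mulmxDr mulmxDl mulmx1 gh !mulmxA. Qed.

End Pairing.

(** * Root subgroups contained in a monoid of matrices *)

Definition mxmonoid (F : comNzRingType) n (S : set 'M[F]_n) : Prop :=
  S 1%:M /\ forall A B, S A -> S B -> S (A *m B).

(** The whole one-parameter group of transvections is required in [S], which makes the notion stable
    under scaling [v] or [phi]. *)
Definition rootsub (F : comNzRingType) n (S : set 'M[F]_n) v phi : Prop :=
  pairing phi v = 0 /\ forall c, S (transv (c *: v) phi).

Section RootSubgroups.
Variables (F : fieldType) (n : nat) (S : set 'M[F]_n).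
Hypothesis SM : mxmonoid S.
Implicit Types (v w : 'cV[F]_n) (phi psi : 'rV[F]_n).
Local Notation rootsub := (rootsub S).

Lemma rootsub0l phi : rootsub 0 phi.
Proof. by split=> [|c]; rewrite ?pairingE // scaler0 transv0l; case: SM. Qed.
Lemma rootsub0r v : rootsub v 0.
Proof. by split=> [|c]; rewrite ?pairingE // transv0r; case: SM. Qed.

Lemma rootsubZl d v phi : rootsub v phi -> rootsub (d *: v) phi.
Proof.
by case=> pv H; split=> [|c]; rewrite ?pairingE ?pv ?mulr0 // scalerA.
Qed.

Lemma rootsubZr d v phi : rootsub v phi -> rootsub v (d *: phi).
Proof.
case=> pv H; split=> [|c]; rewrite ?pairingE ?pv ?mulr0 //.
by rewrite /transv -scalemxAr scalemxAl scalerA; exact: H.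
Qed.

Lemma rootsubDl v w phi : rootsub v phi -> rootsub w phi -> rootsub (v + w) phi.
Proof.
case=> pv Hv [pw Hw]; split=> [|c]; first by rewrite pairingE pv pw addr0.
rewrite scalerDr -transvDl ?pairingE ?pw ?mulr0 //.
by case: SM => _; apply.
Qed.

Lemma rootsubDr v phi psi :
  rootsub v phi -> rootsub v psi -> rootsub v (phi + psi).
Proof.
case=> pv Hv [pw Hw]; split=> [|c]; first by rewrite pairingE pv pw addr0.
rewrite -transvDr ?pairingE ?pv ?mulr0 //.
by case: SM => _; apply.
Qed.

(** The inverse [h] is asked to lie in [S] separately, since [S] is only a monoid. *)
Lemma rootsubJ g h v phi : S g -> S h -> g *m h = 1%:M -> h *m g = 1%:M ->
  rootsub v phi -> rootsub (g *m v) (phi *m h).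
Proof.
move=> Sg Sh gh hg [pv H]; split=> [|c].
  by rewrite /pairing -mulmxA [h *m _]mulmxA hg mul1mx.
rewrite scalemxAr -transv_conj //.
by case: SM => _ M; apply: (M) => //; apply: M.
Qed.

(** Conjugation by the transvection of [w] and [psi]; this produces the new root subgroups in both
    parities. *)
Lemma rootsub_transv w psi v phi : rootsub w psi -> rootsub v phi ->
  rootsub (v + pairing psi v *: w) (phi - pairing phi w *: psi).
Proof.
case=> pw Hw; rewrite -transv_mulmx -scaleNr -pairingNr -mulmx_transv.
apply: rootsubJ; rewrite ?transvK ?transvVK //.
  by rewrite -[w]scale1r; apply: Hw.
by rewrite -scaleN1r; apply: Hw.
Qed.

End RootSubgroups.

(** * The moment curve and its dual curve *)

Section MomentCurve.
Variables (F : numFieldType) (n : nat).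

Definition nu (u : F) : 'cV[F]_n.+1 := mat_a n.+1 u *m delta_mx ord_max 0.
Definition nud (u : F) : 'rV[F]_n.+1 := delta_mx 0 ord0 *m mat_a n.+1 (- u).

Lemma nuE u i : nu u i 0 = u ^+ (n - i) / (n - i)`!%:R.
Proof. by rewrite /nu -colE mxE mat_aij /= -ltnS ltn_ord. Qed.

Lemma nudE u j : nud u 0 j = (- u) ^+ j / j`!%:R.
Proof. by rewrite /nud -rowE mxE mat_aij /= subn0. Qed.

(** The pairing is the upper right corner entry of [a(-u) a(w) = a(w - u)]. *)
Lemma nud_nu u w : pairing (nud u) (nu w) = (w - u) ^+ n / n`!%:R.
Proof.
rewrite /pairing /nud /nu mulmxA -[_ *m _ *m mat_a _ w]mulmxA mat_aD.
by rewrite -rowE -colE mxE mxE mat_aij /= subn0 addrC.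
Qed.

Lemma mat_b_transv (s : F) :
  mat_b n.+1 s = transv (s *: delta_mx ord_max 0) (delta_mx 0 ord0).
Proof.
rewrite /mat_b /transv -scalemxAl; congr (_ + _ *: _).
by apply/matrixP => i j; rewrite nilp_yE mul_delta_mx mxE eqSS.
Qed.

Lemma rootsub_nu (S : set 'M[F]_n.+1) u : (0 < n)%N -> mxmonoid S ->
  (forall u, S (mat_a n.+1 u)) -> (forall u, S (mat_b n.+1 u)) ->
  rootsub S (nu u) (nud u).
Proof.
move=> n0 SM Sa Sb; rewrite /nu /nud.
apply: rootsubJ; rewrite ?mat_aD ?subrr ?addNr ?mat_a0 //.
split=> [|c]; last by rewrite -mat_b_transv.
by rewrite /pairing -rowE !mxE /= -val_eqE /= eq_sym eqn0Ngt n0.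
Qed.

(** The functional [phi] along the moment curve, as a polynomial in the parameter: vanishing at a
    point of the curve becomes having a root. *)
Definition nupoly (phi : 'rV[F]_n.+1) : {poly F} :=
  \sum_(i < n.+1) (phi 0 i / (n - i)`!%:R) *: 'X^(n - i).

Lemma nupolyE phi u : (nupoly phi).[u] = pairing phi (nu u).
Proof.
rewrite /nupoly horner_sum /pairing mxE; apply: eq_bigr => i _.
by rewrite hornerZ hornerXn nuE mulrAC mulrA.
Qed.

Lemma nupoly_coef phi (i : 'I_n.+1) : (nupoly phi)`_(n - i) = phi 0 i / (n - i)`!%:R.
Proof.
rewrite /nupoly coef_sum (bigD1 i) //= big1 ?addr0 => [|j ji].
  by rewrite coefZ coefXn eqxx mulr1.
rewrite coefZ coefXn; case: eqP => [E|_]; last by rewrite mulr0.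
by case/eqP: ji; apply: val_inj; rewrite -[LHS](@subKn j n) -?E ?subKn // -ltnS.
Qed.

Lemma nupoly_eq0 phi : nupoly phi = 0 -> phi = 0.
Proof.
move=> E; apply/rowP => i; move: (nupoly_coef phi i); rewrite E coef0 mxE => /esym/eqP.
by rewrite mulf_eq0 invr_eq0 pnatr_eq0 eqn0Ngt fact_gt0 orbF => /eqP.
Qed.

Lemma size_nupoly phi : (size (nupoly phi) <= n.+1)%N.
Proof.
apply: (leq_trans (size_sum _ _ _)); apply/bigmax_leqP => i _.
by apply: (leq_trans (size_scale_leq _ _)); rewrite size_polyXn ltnS leq_subr.
Qed.

(** The product of the nonzero polynomials [nupoly phi] is nonzero, so some parameter is a root of
    none of them. *)
Lemma nu_generic (s : seq 'rV[F]_n.+1) : all (fun phi => phi != 0) s ->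
  exists u, all (fun phi => pairing phi (nu u) != 0) s.
Proof.
move=> s0; pose q := \prod_(phi <- s) nupoly phi.
have q0 : q != 0.
  rewrite prodf_seq_neq0; apply/allP => phi /(allP s0) /=.
  by apply: contra => /eqP/nupoly_eq0 ->.
have [u qu] : exists u, q.[u] != 0.
  apply: contrapT => /forallNP H; case/eqP: q0.
  apply: (@poly_natmul_roots _ _ 1); rewrite ?oner_eq0 // => k.
  by apply/eqP/negbNE/negP/H.
exists u; move: qu; rewrite horner_prod prodf_seq_neq0 => /allP H.
by apply/allP => phi /H /=; rewrite nupolyE.
Qed.

(** The points [nu 0], ..., [nu n] form a basis: a functional killing all of them has a [nupoly] of
    degree at most [n] with [n + 1] roots. *)
Lemma nu_ind (P : 'cV[F]_n.+1 -> Prop) : P 0 ->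
  (forall v c u, P v -> P (v + c *: nu u)) -> forall v, P v.
Proof.
move=> P0 PD v.
pose N : 'M[F]_n.+1 := \matrix_(i, j) nu j%:R i 0.
have uN : N \in unitmx.
  rewrite -row_free_unit -kermx_eq0; apply/eqP/row_matrixP => i; rewrite row0.
  set phi := row i _.
  have phiN : phi *m N = 0 by rewrite -row_mul mulmx_ker row0.
  apply/nupoly_eq0/eqP; apply: contraT => q0.
  pose rs := [seq (k%:R : F) | k <- iota 0 n.+1].
  have := @max_poly_roots _ (nupoly phi) rs q0.
  move/(_ _ _)/leq_trans/(_ (size_nupoly phi)).
  rewrite size_map size_iota ltnn => -> //.
    apply/allP => _ /mapP[k + ->]; rewrite mem_iota /= => kn.
    rewrite /root nupolyE; apply/eqP.
    transitivity ((phi *m N) 0 (Ordinal kn)); last by rewrite phiN mxE.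
    by rewrite /pairing mxE [RHS]mxE; apply: eq_bigr => j _; rewrite [N _ _]mxE.
  by rewrite map_inj_uniq ?iota_uniq //; exact: mulrIn (oner_neq0 F).
have -> : v = \sum_j (invmx N *m v) j 0 *: nu j%:R.
  rewrite -[LHS](mulKVmx uN); apply/colP => i; rewrite mxE summxE.
  by apply: eq_bigr => j _; rewrite mxE mulrC [in RHS]mxE.
elim: (index_enum _) => [|j r IH]; first by rewrite big_nil.
by rewrite big_cons addrC; apply: PD.
Qed.

Lemma nu_ord_max u : nu u ord_max 0 = 1.
Proof. by rewrite nuE subnn expr0 divr1. Qed.

End MomentCurve.

(** * The form J; generation of the special linear group *)

Lemma symp_JE (F : pzRingType) n (i j : 'I_n) :
  symp_J F n i j = if j == rev_ord i then (-1) ^+ i.+1 else 0.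
Proof.
rewrite /symp_J summxE (bigD1 i) //= big1 ?addr0 => [|k ki].
  by rewrite !mxE eqxx /=; case: eqP; rewrite ?mulr1 ?mulr0.
by rewrite !mxE eq_sym (negbTE ki) mulr0.
Qed.

Lemma symp_JJ (F : pzRingType) n : symp_J F n *m symp_J F n = ((-1) ^+ n.+1)%:M.
Proof.
apply/matrixP => i j; rewrite mxE (bigD1 (rev_ord i)) //= big1 ?addr0 => [|k ki].
  rewrite !symp_JE eqxx rev_ordK mxE eq_sym.
  case: eqP => [->|]; rewrite ?mulr0 // -exprD mulr1n.
  by congr (_ ^+ _); have := ltn_ord j; rewrite /=; lia.
by rewrite symp_JE (negbTE ki) mul0r.
Qed.

(** Identifies the dual curve with the image of the curve under [J], up to a sign, in both
    parities. *)
Lemma nud_sympJ (F : numFieldType) n (u : F) :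
  nud n u = (-1) ^+ n.+1 *: ((nu n u)^T *m symp_J F n.+1).
Proof.
apply/rowP => j; rewrite nudE !mxE (bigD1 (rev_ord j)) //= big1 ?addr0.
  rewrite symp_JE rev_ordK eqxx mxE nuE /= subSS subKn ?leq_ord // (exprNn u).
  rewrite -mulrA mulrC [RHS]mulrCA -exprD -signr_odd; congr (_ * _).
  by rewrite -[RHS]signr_odd; congr (_ ^+ _); have := ltn_ord j; lia.
move=> k kj; rewrite symp_JE; case: eqP => [E|]; last by rewrite mulr0.
by case/eqP: kj; rewrite E rev_ordK.
Qed.

Lemma det_transv (F : comNzRingType) n (v : 'cV[F]_n) phi :
  pairing phi v = 0 -> \det (transv v phi) = 1.
Proof.
move=> pv.
(* Sylvester's trick: two products of block triangular matrices, whose upper left entries agree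
   because [phi] kills [v]. *)
have E : block_mx 1%:M 0 v 1%:M *m block_mx 1%:M (- phi) 0 (transv v phi) =
    block_mx 1%:M (- phi) 0 1%:M *m block_mx 1%:M 0 v 1%:M :> 'M_(1 + n).
  rewrite !mulmx_block !(mulmx1, mul1mx, mul0mx, mulmx0, addr0, add0r).
  rewrite mulmxN addrC addrK mulNmx [phi *m v]mx11_scalar -/(pairing _ _) pv.
  by rewrite raddf0 oppr0 addr0.
move/(congr1 determinant): E.
by rewrite !det_mulmx !det_lblock !det_ublock !det1 !mul1r.
Qed.

(** * Transvections generate the special linear group *)

Section SpecialLinear.
Variables (F : fieldType) (n : nat) (S : set 'M[F]_n).
Hypothesis SM : mxmonoid S.
Hypothesis St : forall v phi, pairing phi v = 0 -> S (transv v phi).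

Definition fixes_below (k : nat) (A : 'M[F]_n) :=
  forall i j : 'I_n, (j < k)%N -> A i j = (i == j)%:R.

Let e (i : 'I_n) : 'cV[F]_n := delta_mx i 0.
Let ed (i : 'I_n) : 'rV[F]_n := delta_mx 0 i.

Lemma pairing_ed i v : pairing (ed i) v = v i 0.
Proof. by rewrite /pairing -rowE mxE. Qed.

Lemma transv_mem_cancel A v phi : pairing phi v = 0 ->
  S (transv v phi *m A) -> S A.
Proof.
move=> pv SA; rewrite -[A]mul1mx -(transvVK pv) -mulmxA.
by case: SM => _; apply => //; apply: St; rewrite pairingE pv oppr0.
Qed.

Lemma fixes_below_transv k A v (phi : 'rV_n) : (forall j : 'I_n, (j < k)%N -> phi 0 j = 0) ->
  fixes_below k A -> fixes_below k (transv v phi *m A).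
Proof.
move=> phik Ak i j jk.
rewrite mulmxDl mul1mx -mulmxA mxE Ak // [X in _ + X]mxE big_ord1 mxE.
rewrite big1 ?mulr0 ?addr0 // => l _.
by rewrite Ak //; have [->|] := eqVneq l j; rewrite ?mulr0 // phik ?mul0r.
Qed.

Lemma fixes_belowS (k : 'I_n) A : fixes_below k A -> col k A = e k ->
  fixes_below k.+1 A.
Proof.
move=> Ak Ake i j; rewrite ltnS leq_eqVlt => /orP[/eqP/val_inj->|/Ak //].
by have /colP/(_ i) := Ake; rewrite !mxE andbT.
Qed.

Lemma col_transv_mulmx k v (phi : 'rV_n) (A : 'M[F]_n) :
  col k (transv v phi *m A) = col k A + pairing phi (col k A) *: v.
Proof. by rewrite !colE -mulmxA transv_mulmx. Qed.

(** Column reduction from left to right: left multiplication by transvections makes column [k]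
    standard without disturbing the earlier ones. *)
Lemma SL_sub_transv : SLmx F n `<=` S.
Proof.
suff H d k A : (k + d)%N = n -> \det A = 1 -> fixes_below k A -> S A.
  by move=> A A1; apply: (H n 0%N).
elim: d k A => [|d IH] k0 A kn A1 Ak.
  suff -> : A = 1%:M by case: SM.
  apply/matrixP => i j; rewrite mxE Ak //.
  by move: kn; rewrite addn0 => ->.
have k0n : (k0 < n)%N by rewrite -kn addnS ltnS leq_addr.
pose k := Ordinal k0n; have {}Ak : fixes_below k A := Ak.
(* Once [phi] vanishes on the fixed vectors and takes the value 1 at both
   [e k] and [A (e k)], the transvection along their difference does the job. *)
have main B (phi : 'rV_n) : \det B = 1 -> fixes_below k B ->
    (forall j : 'I_n, (j < k)%N -> phi 0 j = 0) -> phi 0 k = 1 ->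
    pairing phi (col k B) = 1 -> S B.
  move=> B1 Bk phik phi1 phiB.
  have pe : pairing phi (e k) = 1 by rewrite /pairing -colE mxE.
  have pv : pairing phi (e k - col k B) = 0 by rewrite !pairingE pe phiB subrr.
  apply: (transv_mem_cancel pv); apply: (IH k0.+1).
  - by rewrite addSn -addnS.
  - by rewrite det_mulmx B1 det_transv // mulr1.
  apply: (@fixes_belowS k); first exact: fixes_below_transv.
  by rewrite col_transv_mulmx phiB scale1r addrC subrK.
have edE i j : ed i 0 j = (j == i)%:R by rewrite mxE eqxx.
have step1 B (l : 'I_n) : \det B = 1 -> fixes_below k B -> (k < l)%N ->
    B l k != 0 -> S B.
  move=> B1 Bk kl Blk.
  (* The coefficient of [ed l] adjusts the value on column [k] to 1 and leaves the value 1 at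
     [e k]. *)
  apply: (main B (ed k + ((1 - B k k) / B l k) *: ed l)) => //.
  - move=> j jk; rewrite !(edE, mxE) -!val_eqE.
    by rewrite (ltn_eqF jk) (ltn_eqF (ltn_trans jk kl)) mulr0 addr0.
  - by rewrite !(edE, mxE) eqxx -val_eqE (ltn_eqF kl) mulr0 addr0.
  - by rewrite !pairingE !pairing_ed !mxE divfK // addrC subrK.
have [/existsP[l /andP[kl Alk]]|/existsPn nl] :=
  boolP [exists l : 'I_n, (k < l)%N && (A l k != 0)].
  exact: step1 kl Alk.
have Al0 (l : 'I_n) : (k < l)%N -> A l k = 0.
  by move=> kl; move: (nl l); rewrite kl negbK => /eqP.
have Akk : A k k != 0.
  apply: contra_eq_neq A1 => Akk; rewrite eq_sym.
  have Alk (l : 'I_n) : (k <= l)%N -> A l k = 0.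
    rewrite leq_eqVlt => /orP[/eqP kl|/Al0 //].
    by rewrite (_ : l = k) //; apply: val_inj.
  (* Column [k] is now a combination of the vectors [e j] with [j < k], which [A] fixes; so [A]
     sends it and [e k] to the same vector, although their difference has [k]-th entry 1. *)
  have uA0 : A *m (e k - col k A) = 0.
    rewrite mulmxBr -colE; apply/eqP; rewrite subr_eq0; apply/eqP/colP => i.
    rewrite mxE [RHS]mxE (bigID (fun j : 'I_n => j < k)%N) /= [X in _ + X]big1.
      rewrite addr0 (eq_bigr (fun j => (i == j)%:R * A j k)) => [|j jk].
        have [ik|ki] := ltnP i k.
          rewrite (bigD1 i) //= eqxx mul1r big1 ?addr0 // => j /andP[_].
          by rewrite eq_sym => /negbTE->; rewrite mul0r.
        rewrite big1 => [|j jk]; last first.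
          by rewrite -val_eqE (gtn_eqF (leq_trans jk ki)) mul0r.
        by rewrite Alk.
      by rewrite Ak // mxE.
    by move=> j; rewrite -leqNgt mxE => /Alk ->; rewrite mulr0.
  apply/eqP => A1; have uA : A \in unitmx by rewrite unitmxE -A1 unitr1.
  have : (invmx A *m (A *m (e k - col k A))) k 0 = 0 by rewrite uA0 mulmx0 mxE.
  rewrite mulKmx // !mxE !eqxx Akk subr0 => /eqP; by rewrite oner_eq0.
have [kn1|kn1] := ltnP k.+1 n.
  (* Adding row [k] to row [l] creates the nonzero entry below the diagonal that [step1] asks
     for. *)
  pose l := Ordinal kn1.
  have pv : pairing (ed k) (e l) = 0.
    by rewrite pairing_ed mxE -val_eqE /= (ltn_eqF (ltnSn _)).
  apply: (transv_mem_cancel pv); apply: (step1 _ l) => //.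
  - by rewrite det_mulmx A1 det_transv // mulr1.
  - by apply: fixes_below_transv => // j jk; rewrite edE -val_eqE ltn_eqF.
  have := congr1 (fun v : 'cV_n => v l 0) (col_transv_mulmx k (e l) (ed k) A).
  by rewrite pairing_ed !mxE !eqxx /= mulr1 Al0 // add0r => ->.
(* In the last column [A] is upper triangular with all other diagonal entries 1, so the determinant
   forces [A k k = 1]. *)
apply: (main A (ed k)) => //; first 2 last.
- rewrite pairing_ed mxE -[RHS]A1 -det_tr det_trig.
    rewrite (bigD1 k) //= big1 ?mulr1 ?mxE // => i ik; rewrite mxE Ak ?eqxx //.
    by rewrite ltn_neqAle ik -ltnS (leq_trans (ltn_ord i)).
  apply/is_trig_mxP => i j ij; rewrite mxE Ak -?val_eqE ?gtn_eqF //.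
  by rewrite -ltnS (leq_trans _ kn1) // (leq_trans _ (ltn_ord j)).
- by move=> j jk; rewrite edE -val_eqE ltn_eqF.
- by rewrite edE eqxx.
Qed.

End SpecialLinear.

(** * Odd dimension *)

Section OddDimension.
Variables (F : numFieldType) (n : nat) (S : set 'M[F]_n.+1).
Hypotheses (SM : mxmonoid S) (even_n : ~~ odd n).
Hypothesis Snu : forall u, rootsub S (nu n u) (nud n u).

Let delta u w : F := pairing (nud n u) (nu n w).

Lemma nud_nuC u w : delta u w = delta w u.
Proof. by rewrite /delta !nud_nu -[w - u]opprB exprNn -signr_odd (negbTE even_n) mul1r. Qed.

Lemma nud_nu_neq0 u w : u != w -> delta u w != 0.
Proof.
move=> uw; rewrite eq_sym in uw; rewrite /delta nud_nu mulf_neq0 ?expf_neq0 ?subr_eq0 //.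
by rewrite invr_eq0 pnatr_eq0 -lt0n fact_gt0.
Qed.

Lemma nud_nu0 u : delta u u = 0.
Proof. by case: (Snu u). Qed.

(** Conjugating the transvection at [u3] by one at [u1] produces a functional
    vanishing at [nu u2]; conjugating then by the one at [u2] changes only the
    vector, by a multiple of [nu u2]. That multiple is nonzero because
    [delta] is symmetric. *)
Lemma rootsub_nu_three u1 u2 u3 : u1 != u2 ->
  rootsub S (nu n u2) (delta u1 u2 *: nud n u3 - delta u2 u3 *: nud n u1).
Proof.
move=> u12; have d12 := nud_nu_neq0 u12.
have [->|u31] := eqVneq u3 u1.
  by rewrite [delta u2 u1]nud_nuC subrr; exact: rootsub0r.
have [->|u32] := eqVneq u3 u2.
  by rewrite nud_nu0 scale0r subr0; apply: rootsubZr.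
have d13 : delta u1 u3 != 0 by rewrite nud_nuC; exact: nud_nu_neq0.
have d23 : delta u2 u3 != 0 by rewrite nud_nuC; exact: nud_nu_neq0.
pose c := delta u2 u3 / (delta u1 u3 * delta u1 u2).
have H13 := rootsub_transv SM (rootsubZl c (Snu u1)) (Snu u3).
have H2 := rootsub_transv SM (Snu u2) H13.
set v := _ + _ in H13; set phi := nud n u3 - _ in H13.
have phi2 : pairing phi (nu n u2) = 0.
  rewrite !pairingE -![pairing _ _]/(delta _ _).
  by rewrite /c (nud_nuC u3 u1) (nud_nuC u3 u2); field; rewrite d12 d13.
have phi2v : pairing (nud n u2) v = delta u2 u3 *+ 2.
  rewrite !pairingE -![pairing _ _]/(delta _ _).
  by rewrite /c (nud_nuC u2 u1); field; rewrite d12 d13.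
rewrite phi2 scale0r subr0 phi2v in H2.
have := rootsubDl SM H2 (rootsubZl (-1) H13).
rewrite scaleN1r addrAC subrr add0r.
move/(rootsubZl (delta u2 u3 *+ 2)^-1).
rewrite scalerA mulVf ?scale1r; last by rewrite mulrn_eq0 (negbTE d23).
move/(rootsubZr (delta u1 u2)); congr (rootsub S _ _).
rewrite scalerBr scalerA; congr (_ - _ *: _).
by rewrite !pairingE -![pairing _ _]/(delta _ _) /c (nud_nuC u3 u1); field; rewrite d12 d13.
Qed.

(** The functional [delta w u *: phi - pairing phi (nu n u) *: nud n w] is linear in [phi], and
    [rootsub_nu_three] treats [phi = nud n x]. These span all functionals, and for [phi = psi] the
    correction term disappears. *)
Lemma rootsub_nu_all u psi : pairing psi (nu n u) = 0 -> rootsub S (nu n u) psi.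
Proof.
move=> psi0; pose w := u + 1.
have wu : w != u by rewrite -subr_eq0 addrAC subrr add0r oner_eq0.
have dwu := nud_nu_neq0 wu.
suff H v : rootsub S (nu n u) (delta w u *: (v^T *m symp_J F n.+1) -
    pairing (v^T *m symp_J F n.+1) (nu n u) *: nud n w).
  (* As [J] squares to a sign, this vector represents [psi] through [J]. *)
  have := H ((-1) ^+ n.+2 *: (psi *m symp_J F n.+1)^T).
  have -> : ((-1) ^+ n.+2 *: (psi *m symp_J F n.+1)^T)^T *m symp_J F n.+1 = psi.
    rewrite linearZ /= trmxK -scalemxAl -mulmxA symp_JJ mul_mx_scalar scalerA.
    by rewrite -exprD addnn -signr_odd odd_double scale1r.
  rewrite psi0 scale0r subr0.
  by move/(rootsubZr (delta w u)^-1); rewrite scalerA mulVf ?scale1r.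
move: v; apply: nu_ind.
  by rewrite trmx0 mul0mx pairingE scaler0 scale0r subrr; exact: rootsub0r.
move=> v c x.
have -> : (v + c *: nu n x)^T *m symp_J F n.+1 =
    v^T *m symp_J F n.+1 + (c * (-1) ^+ n.+1) *: nud n x.
  rewrite nud_sympJ scalerA -mulrA -exprD addnn -signr_odd odd_double mulr1.
  by rewrite linearD linearZ /= mulmxDl -scalemxAl.
move/(rootsubDr SM); move/(_ _ (rootsubZr (c * (-1) ^+ n.+1) (rootsub_nu_three x wu))).
congr (rootsub S _ _).
rewrite !pairingE -/(delta _ _) [delta x u]nud_nuC.
apply/rowP => i; rewrite !mxE; set a := \sum_(_ | _) _; set b := pairing _ _.
ring.
Qed.

(** If [w] is not a multiple of [nu u], a transvection in direction [nu u] carries [w] to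
    [w + c *: nu u], and conjugation by it transports the root subgroups; otherwise the sum is
    itself a multiple of [nu u]. *)
Lemma transv_mem_odd v psi : pairing psi v = 0 -> S (transv v psi).
Proof.
suff H w : forall phi, pairing phi w = 0 -> rootsub S w phi.
  by move=> /H[_ /(_ 1)]; rewrite scale1r.
move: w; apply: nu_ind => [phi _|w c u Pw phi phi0]; first exact: rootsub0l.
have [/existsP[i wi]|/existsPn wi] :=
  boolP [exists i, w i 0 - w ord_max 0 * nu n u i 0 != 0].
  (* Since [nu u] has last coordinate 1, [psi0] kills it; the scalar normalizes the value at [w] to
     1. *)
  pose psi0 : 'rV[F]_n.+1 := (w i 0 - w ord_max 0 * nu n u i 0)^-1 *:
    (delta_mx 0 i - nu n u i 0 *: delta_mx 0 ord_max).
  have psiu : pairing psi0 (nu n u) = 0.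
    by rewrite !pairingE !pairing_ed nu_ord_max mulr1 subrr mulr0.
  have psiw : pairing psi0 w = 1.
    by rewrite !pairingE !pairing_ed [nu n u i 0 * _]mulrC mulVf.
  have [_ Sg] := rootsub_nu_all psiu.
  have pc : pairing psi0 (c *: nu n u) = 0 by rewrite pairingZr psiu mulr0.
  have gw : transv (c *: nu n u) psi0 *m w = w + c *: nu n u.
    by rewrite transv_mulmx psiw scale1r.
  rewrite -gw -[phi]mulmx1 -(transvK pc) mulmxA.
  apply: rootsubJ; rewrite ?transvK ?transvVK //; first by rewrite -scaleNr; exact: Sg.
  by apply: Pw; rewrite pairing_mulmx gw.
have wE : w = w ord_max 0 *: nu n u.
  by apply/colP => i; move: (wi i); rewrite negbK subr_eq0 => /eqP ->; rewrite [RHS]mxE.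
move: phi0; rewrite wE -scalerDl; set d := _ + c; rewrite pairingE.
move=> /eqP; rewrite mulf_eq0 => /orP[/eqP->|/eqP/rootsub_nu_all H].
  by rewrite scale0r; exact: rootsub0l.
exact: rootsubZl.
Qed.

End OddDimension.

(** * Even dimension *)

Section Symplectic.
Variables (F : numFieldType) (n : nat).
Hypothesis even_n : ~~ odd n.
Local Notation J := (symp_J F n).
Implicit Types (u v w : 'cV[F]_n) (g h : 'M[F]_n).

Lemma symp_J2 : J *m J = - 1%:M.
Proof. by rewrite symp_JJ -signr_odd /= even_n expr1 raddfN. Qed.

Lemma trmx_symp_J : J^T = - J.
Proof.
apply/matrixP => i j; rewrite mxE [RHS]mxE !symp_JE.
rewrite -(inj_eq rev_ord_inj) rev_ordK eq_sym.
case: eqP => [->|_]; last by rewrite oppr0.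
rewrite -signr_odd -[in RHS]signr_odd.
have -> : odd i.+1 = ~~ odd (rev_ord i).+1.
  by move: even_n; have := ltn_ord i; rewrite /=; lia.
by case: (odd _); rewrite ?expr0 ?expr1 ?opprK.
Qed.

(** Transposed with respect to [Spmx], to suit the action on columns; [SpmxP] shows that both
    conditions agree. *)
Definition symplectic g := g^T *m J *m g = J.

(** Since [J] squares to -1, [- (J *m g^T *m J)] is a left inverse of [g], hence also a right
    inverse. *)
Lemma symplectic_tr g : symplectic g -> symplectic g^T.
Proof.
rewrite /symplectic trmxK => gJ.
have /mulmx1C gV : - (J *m g^T *m J) *m g = 1%:M.
  by rewrite mulNmx -!mulmxA [g^T *m _]mulmxA gJ symp_J2 opprK.
have : g *m J *m g^T *m J *m J = - J.
  by rewrite -[in RHS](mul1mx J) -gV mulmxN mulNmx opprK !mulmxA.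
by rewrite -mulmxA symp_J2 mulmxN mulmx1 => /oppr_inj.
Qed.

Lemma SpmxP g : Spmx F n g <-> symplectic g.
Proof.
split=> [[_ gJ]|gJ]; first by rewrite -[g]trmxK; apply: symplectic_tr; rewrite /symplectic trmxK.
split; last by have := symplectic_tr gJ; rewrite /symplectic trmxK.
have : - (J *m g^T *m J) *m g = 1%:M.
  by rewrite mulNmx -!mulmxA [g^T *m _]mulmxA gJ symp_J2 opprK.
by case/mulmx1_unit.
Qed.

Lemma symplecticM g h : symplectic g -> symplectic h -> symplectic (g *m h).
Proof.
rewrite /symplectic => gJ hJ.
by rewrite trmx_mul -!mulmxA [J *m _]mulmxA [g^T *m _]mulmxA [g^T *m _]mulmxA gJ mulmxA.
Qed.

Definition sd v : 'rV[F]_n := v^T *m J.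
Definition omega v w : F := pairing (sd v) w.

Lemma sdD v w : sd (v + w) = sd v + sd w.
Proof. by rewrite /sd linearD /= mulmxDl. Qed.
Lemma sdZ c v : sd (c *: v) = c *: sd v.
Proof. by rewrite /sd linearZ /= -scalemxAl. Qed.

Lemma omegaC v w : omega v w = - omega w v.
Proof.
have E : (v^T *m J *m w)^T = - (w^T *m J *m v).
  by rewrite !trmx_mul trmxK trmx_symp_J mulNmx mulmxN mulmxA.
by move/matrixP/(_ 0 0): E; rewrite mxE [RHS]mxE.
Qed.

Lemma omega0 v : omega v v = 0.
Proof. by apply/eqP; rewrite -eqNr -omegaC. Qed.

Lemma omegaDl u v w : omega (u + v) w = omega u w + omega v w.
Proof. by rewrite /omega sdD pairingE. Qed.
Lemma omegaZl c v w : omega (c *: v) w = c * omega v w.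
Proof. by rewrite /omega sdZ pairingE. Qed.
Lemma omegaNl v w : omega (- v) w = - omega v w.
Proof. by rewrite -scaleN1r omegaZl mulN1r. Qed.
Lemma omegaDr u v w : omega u (v + w) = omega u v + omega u w.
Proof. exact: pairingDr. Qed.
Lemma omegaZr c v w : omega v (c *: w) = c * omega v w.
Proof. exact: pairingZr. Qed.
Lemma omegaNr v w : omega v (- w) = - omega v w.
Proof. exact: pairingNr. Qed.
Definition omegaE := (omegaDl, omegaZl, omegaNl, omegaDr, omegaZr, omegaNr).

Lemma omega_symplectic g v w : symplectic g -> omega (g *m v) (g *m w) = omega v w.
Proof.
by move=> gJ; rewrite /omega /sd /pairing trmx_mul -[in RHS]gJ !mulmxA.
Qed.

Lemma omega_delta (i j : 'I_n) :
  omega (delta_mx i 0) (delta_mx j 0) = J i j.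
Proof. by rewrite /omega /pairing /sd trmx_delta -rowE -colE mxE mxE. Qed.

Lemma symplectic_transv c v : symplectic (transv (c *: v) (sd v)).
Proof.
rewrite /symplectic; have -> : (transv (c *: v) (sd v))^T *m J =
    J *m transv (- (c *: v)) (sd v).
  rewrite /transv linearD /= trmx1 mulmxDl mulmxDr mul1mx mulmx1; congr (_ + _).
  rewrite /sd !trmx_mul trmxK linearZ /= trmx_symp_J.
  rewrite -!(scalemxAl, scalemxAr) !(mulNmx, mulmxN) -!(scalemxAl, scalemxAr).
  by rewrite !mulmxA scalerN.
by rewrite -mulmxA transvVK ?mulmx1 // pairingZr -/(omega v v) omega0 mulr0.
Qed.

(** * Symplectic transvections generate the symplectic group *)

Section Generation.
Variable S : set 'M[F]_n.
Hypothesis SM : mxmonoid S.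
Hypothesis St : forall v c, S (transv (c *: v) (sd v)).

(** Membership in [S] is recorded for the inverse [T']: it is what recovers [g] from [T *m g]. *)
Definition moves (X : set 'cV[F]_n) v u := exists T T' : 'M[F]_n,
  [/\ S T', T' *m T = 1%:M, symplectic T, T *m v = u & forall w, X w -> T *m w = w].

(** The symplectic transvection along [v - u] with coefficient [(omega u v)^-1] does it, and it
    fixes whatever is orthogonal to [v - u]. *)
Lemma moves_direct X v u : omega u v != 0 ->
  (forall w, X w -> omega (v - u) w = 0) -> moves X v u.
Proof.
move=> uv Xw; pose c := (omega u v)^-1.
exists (transv (c *: (v - u)) (sd (v - u))), (transv (- c *: (v - u)) (sd (v - u))).
split=> //.
- by rewrite scaleNr transvVK // pairingZr -/(omega _ _) omega0 mulr0.
- exact: symplectic_transv.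
- rewrite transv_mulmx -/(omega _ _) omegaDl omegaNl omega0 add0r scalerA mulNr.
  by rewrite mulfV // scaleN1r opprB addrC subrK.
- by move=> w /Xw w0; rewrite transv_mulmx -/(omega _ _) w0 scale0r addr0.
Qed.

Lemma moves_trans X u v w : moves X u v -> moves X v w -> moves X u w.
Proof.
move=> [T [T' [ST TT iT Tu TX]]] [U [U' [SU UU iU Uv UX]]].
exists (U *m T), (T' *m U'); split.
- by case: SM => _; apply.
- by rewrite mulmxA -[_ *m U' *m U]mulmxA UU mulmx1.
- exact: symplecticM.
- by rewrite -mulmxA Tu.
- by move=> x Xx; rewrite -mulmxA TX ?UX.
Qed.

Definition orth (X : set 'cV[F]_n) v := forall w, X w -> omega v w = 0.

Lemma orthD X v w : orth X v -> orth X w -> orth X (v + w).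
Proof. by move=> Xv Xw x Xx; rewrite omegaDl Xv ?Xw ?addr0. Qed.
Lemma orthB X v w : orth X v -> orth X w -> orth X (v - w).
Proof. by move=> Xv Xw x Xx; rewrite omegaDl omegaNl Xv ?Xw ?subr0. Qed.

(** Two direct moves through some [w] orthogonal to neither [u] nor [v]; one of [u'], [v'],
    [u' + v'] qualifies. *)
Lemma moves_orth X v u v' u' : orth X v -> orth X u -> orth X v' -> orth X u' ->
  omega u u' != 0 -> omega v v' != 0 -> moves X v u.
Proof.
move=> Xv Xu Xv' Xu' uu vv.
suff [w [Xw uw wv]] : exists w, [/\ orth X w, omega u w != 0 & omega w v != 0].
  by apply: (@moves_trans _ _ w); apply: moves_direct => //; apply: orthB.
have vv' : omega v' v != 0 by rewrite omegaC oppr_eq0.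
have [u'v|u'v] := eqVneq (omega u' v) 0; last by exists u'.
have [uv'|uv'] := eqVneq (omega u v') 0; last by exists v'.
exists (u' + v'); split; first exact: orthD.
  by rewrite omegaDr uv' addr0.
by rewrite omegaDl u'v add0r.
Qed.

(** Equal pairings with [u] make [v - f] orthogonal to [u]. If [omega f v] vanishes, the detour
    through [u + f] works, since its differences with [v] and [f] are orthogonal to [u] as well. *)
Lemma moves_fix X u v f : orth X u -> orth X v -> orth X f ->
  omega u f != 0 -> omega u v = omega u f ->
  moves (X `|` [set u]) v f.
Proof.
move=> Xu Xv Xf uf uv.
have [fv|fv] := eqVneq (omega f v) 0; last first.
  apply: moves_direct => // w [Xw|->]; first exact: (orthB Xv Xf).
  by rewrite omegaDl omegaNl (omegaC v) (omegaC f) uv subrr.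
apply: (@moves_trans _ _ (u + f)).
  apply: moves_direct; first by rewrite omegaDl fv addr0 uv.
  move=> w [Xw|->]; first exact: (orthB Xv (orthD Xu Xf)).
  by rewrite omegaDl omegaNl omegaDl omega0 add0r (omegaC v) (omegaC f) uv subrr.
apply: moves_direct; first by rewrite omegaDr omega0 addr0 omegaC oppr_eq0.
by rewrite addrK => w [Xw|->]; rewrite ?omega0 ?Xu.
Qed.

(** Induction over the hyperbolic pairs of basis vectors with mirror indices: two moves restore the
    next pair while fixing the earlier ones, until [g] is the identity. *)
Lemma symplectic_mem g : symplectic g -> S g.
Proof.
pose e (i : 'I_n) : 'cV[F]_n := delta_mx i 0.
pose X k : set 'cV[F]_n := [set e i | i in [set i : 'I_n | (i < k)%N || (rev_ord i < k)%N]].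
suff H d k : (k + d)%N = n -> forall g, symplectic g ->
    (forall w, X k w -> g *m w = w) -> S g.
  by move=> gJ; apply: (H n 0%N) => // w [].
clear g; elim: d k => [|d IH] k kn g gJ gX.
  suff -> : g = 1%:M by case: SM.
  apply/matrixP => i j.
  have : g *m e j = e j.
    by apply: gX; exists j => //=; rewrite -[k]addn0 kn ltn_ord.
  by move/colP/(_ i); rewrite -colE !mxE andbT.
have k0n : (k < n)%N by rewrite -kn addnS ltnS leq_addr.
pose k' := Ordinal k0n.
have XS w : X k.+1 w -> [\/ X k w, w = e k' | w = e (rev_ord k')].
  case=> i + <-; rewrite /mkset !ltnS (leq_eqVlt i) (leq_eqVlt (rev_ord i)).
  case/orP=> /orP[/eqP ik|ik].
  - by apply: Or32; congr e; apply: val_inj.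
  - by apply: Or31; exists i => //=; rewrite ik.
  - by apply: Or33; rewrite -(rev_ordK i); congr (e (rev_ord _)); apply: val_inj.
  - by apply: Or31; exists i => //=; rewrite ik orbT.
have {}IH h : symplectic h -> (forall w, X k w -> h *m w = w) ->
    h *m e k' = e k' -> h *m e (rev_ord k') = e (rev_ord k') -> S h.
  move=> hJ hX hk hr; apply: (IH k.+1) => //; first by rewrite addSn -addnS.
  by move=> w /XS[/hX|->|->].
(* Past the middle, the pair was already treated from its mirror index. *)
have [rk|kr] := ltnP (rev_ord k') k.
  apply: IH => //; apply: gX.
    by exists k' => //=; rewrite -/(rev_ord k' : nat) rk orbT.
  by exists (rev_ord k') => //=; rewrite rk.
have orthE (i : 'I_n) : (k <= i)%N -> (k <= rev_ord i)%N -> orth (X k) (e i).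
  move=> ki kri _ [j + <-]; rewrite /mkset omega_delta symp_JE => jk.
  case: eqP => // E; move: jk; rewrite E rev_ordK.
  by rewrite !ltnNge ki kri.
have Xe : orth (X k) (e k') by apply: orthE.
have Xf : orth (X k) (e (rev_ord k')) by apply: orthE; rewrite ?rev_ordK.
have ef : omega (e k') (e (rev_ord k')) != 0.
  by rewrite omega_delta symp_JE eqxx signr_eq0.
have orthg h v : symplectic h -> (forall w, X k w -> h *m w = w) ->
    orth (X k) v -> orth (X k) (h *m v).
  by move=> hJ hX Xv w Xw; rewrite -(hX w) // omega_symplectic // Xv.
have ge : omega (g *m e k') (g *m e (rev_ord k')) != 0 by rewrite omega_symplectic.
have [T [T' [ST TT iT Te TX]]] :=
  moves_orth (orthg _ _ gJ gX Xe) Xe (orthg _ _ gJ gX Xf) Xf ef ge.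
pose g1 := T *m g.
have g1J : symplectic g1 by apply: symplecticM.
have g1X w : X k w -> g1 *m w = w by move=> Xw; rewrite -mulmxA gX ?TX.
have g1e : g1 *m e k' = e k' by rewrite -mulmxA.
have g1f : omega (e k') (g1 *m e (rev_ord k')) = omega (e k') (e (rev_ord k')).
  by rewrite -{1}g1e omega_symplectic.
have [U [U' [SU UU iU Uf UX]]] := moves_fix Xe (orthg _ _ g1J g1X Xf) Xf ef g1f.
have : S (U *m g1).
  apply: IH; first exact: symplecticM.
  - by move=> w Xw; rewrite -mulmxA g1X // UX //; left.
  - by rewrite -mulmxA g1e UX //; right.
  - by rewrite -mulmxA.
case: SM => _ SMM /(SMM _ _ SU); rewrite mulmxA UU mul1mx => /(SMM _ _ ST).
by rewrite mulmxA TT mul1mx.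
Qed.

End Generation.
End Symplectic.

(** * From the moment curve to all symplectic transvections *)

Section EvenDimension.
Variables (F : numFieldType) (n : nat) (S : set 'M[F]_n.+1).
Hypotheses (SM : mxmonoid S) (even_n : ~~ odd n.+1).
Hypothesis Snu : forall u, rootsub S (nu n u) (nud n u).
Local Notation W v := (rootsub S v (sd v)).

Lemma nud_sd (u : F) : nud n u = sd (nu n u).
Proof. by rewrite nud_sympJ -signr_odd (negbTE even_n) scale1r. Qed.

(** Conjugation along [w] with coefficient [c / omega w v] yields the vector; the functional matches
    because [omega] is alternating. *)
Lemma rootsub_sdD v w c : W v -> W w -> omega v w != 0 -> W (v + c *: w).
Proof.
move=> Wv Ww vw; have wv : omega w v != 0 by rewrite omegaC // oppr_eq0.
have := rootsub_transv SM (rootsubZl (c / omega w v) Ww) Wv.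
rewrite -/(omega w v) pairingZr -/(omega v w) scalerA mulrC divfK //.
by rewrite (omegaC even_n v) mulrN divfK // scaleNr opprK sdD sdZ.
Qed.

(** When [v] and [nu u] are orthogonal, [v + c nu u] is reached through a
    generic third point [nu z] of the moment curve, as
    [(v + nu z) + (c nu u - nu z)]. *)
Lemma rootsub_sd v : W v.
Proof.
move: v; apply: nu_ind => [|v c u Wv]; first exact: rootsub0l.
have Wnu x : W (nu n x) by rewrite -nud_sd.
have [v0|v0] := eqVneq v 0.
  by rewrite v0 add0r sdZ; apply/rootsubZl/rootsubZr.
have [vu|vu] := eqVneq (omega v (nu n u)) 0; last exact: rootsub_sdD.
have [s0|s0] := eqVneq (v + c *: nu n u) 0; first by rewrite s0; exact: rootsub0l.
have sd_neq0 (w : 'cV[F]_n.+1) : w != 0 -> sd w != 0.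
  apply: contra_neq => w0; apply/trmx_inj; rewrite trmx0.
  have : sd w *m symp_J F n.+1 = - w^T.
    by rewrite /sd -mulmxA symp_J2 // mulmxN mulmx1.
  by rewrite w0 mul0mx => /esym/eqP; rewrite oppr_eq0 => /eqP.
have nu0 : nu n u != 0.
  by apply/eqP => /colP/(_ ord_max); rewrite nu_ord_max mxE => /eqP; rewrite oner_eq0.
(* The first two functionals allow each half to be formed; the third makes the halves
   non-orthogonal, so that they can be added. *)
have [|z] := @nu_generic F n [:: sd v; sd (nu n u); sd (v + c *: nu n u)].
  by rewrite /= !sd_neq0.
rewrite /= andbT -!/(omega _ _) => /and3P[vz uz sz].
have W1 : W (v + 1 *: nu n z) by apply: rootsub_sdD.
have W2 : W (- 1 *: nu n z + c *: nu n u).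
  apply: rootsub_sdD => //; first by rewrite sdZ; apply/rootsubZl/rootsubZr.
  by rewrite omegaZl omegaC // mulN1r opprK.
have := rootsub_sdD 1 W1 W2.
rewrite !scale1r scaleN1r addrA addrK; apply.
have -> : omega (v + nu n z) (- nu n z + c *: nu n u) =
    - omega (v + c *: nu n u) (nu n z).
  rewrite !omegaE vu omega0 // [omega (nu n z) (nu n u)]omegaC //.
  by ring.
by rewrite oppr_eq0.
Qed.

Lemma Sp_mem : Spmx F n.+1 `<=` S.
Proof.
move=> g /(SpmxP even_n) gJ.
by apply: symplectic_mem gJ => // v c; case: (rootsub_sd v).
Qed.

End EvenDimension.

(** * Words and ping-pong *)

Lemma mulmx1_invmx (F : comUnitRingType) n (A B : 'M[F]_n) :
  A *m B = 1%:M -> invmx A = B.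
Proof.
move=> AB; have [uA _] := mulmx1_unit AB.
by rewrite -[LHS]mulmx1 -AB mulKmx.
Qed.

Lemma exp_invmx (F : comUnitRingType) n (A : 'M[F]_n) k :
  A \in unitmx -> invmx A ^+ k = invmx (A ^+ k).
Proof.
move=> uA; apply/esym/mulmx1_invmx.
elim: k => [|k IH]; first by rewrite !expr0 mulmx1.
rewrite exprSr exprS -[_ * A]/(_ *m _) -[_ * _]/(_ *m _) -mulmxA.
by rewrite [A *m (_ *m _)]mulmxA mulmxV // mul1mx.
Qed.

Section Words.
Variables (F : comUnitRingType) (n r : nat) (g : 'I_r -> 'M[F]_n).
Hypothesis ug : forall i, g i \in unitmx.
Local Notation letter := ('I_r * bool)%type.
Implicit Types (x y : letter) (w : seq letter).

Definition eval_letter x := if x.2 then g x.1 else invmx (g x.1).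
Definition inv_letter x : letter := (x.1, ~~ x.2).
Definition inv_word w := rev (map inv_letter w).
Local Notation compat := (fun x y : letter => ~~ ((x.1 == y.1) && (x.2 != y.2))).

Lemma eval_word0 : eval_word g [::] = 1%:M.
Proof. exact: big_nil. Qed.

Lemma eval_word_cons x w : eval_word g (x :: w) = eval_letter x *m eval_word g w.
Proof. exact: big_cons. Qed.

Lemma eval_word_cat w1 w2 :
  eval_word g (w1 ++ w2) = eval_word g w1 *m eval_word g w2.
Proof. exact: big_cat. Qed.

Lemma eval_letterV x : eval_letter (inv_letter x) = invmx (eval_letter x).
Proof. by case: x => i [] //=; rewrite invmxK. Qed.

Lemma eval_letter_unit x : eval_letter x \in unitmx.
Proof. by case: x => i []; rewrite /eval_letter /= ?unitmx_inv. Qed.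

Lemma eval_word_unit w : eval_word g w \in unitmx.
Proof.
elim: w => [|x w IH]; first by rewrite eval_word0 unitmx1.
by rewrite eval_word_cons unitmx_mul eval_letter_unit.
Qed.

Lemma eval_inv_word w : eval_word g (inv_word w) = invmx (eval_word g w).
Proof.
apply/esym/mulmx1_invmx; elim: w => [|x w IH].
  by rewrite /inv_word /= eval_word0 mulmx1.
rewrite /inv_word /= rev_cons -cats1 eval_word_cat !eval_word_cons eval_word0.
rewrite mulmx1 eval_letterV mulmxA -[_ *m _ *m eval_word g _]mulmxA IH mulmx1.
by rewrite mulmxV ?eval_letter_unit.
Qed.

Lemma reduced_inv_word w : reduced_word w -> reduced_word (inv_word w).
Proof.
rewrite /reduced_word /inv_word rev_sorted sorted_map; apply: sub_sorted => x y /=.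
by rewrite eq_sym; case: x.2; case: y.2.
Qed.

Lemma reduced_behead x w : reduced_word (x :: w) -> reduced_word w.
Proof. exact: path_sorted. Qed.

Lemma reduced_cat w x y w' : reduced_word (rcons w x) ->
  compat x y -> reduced_word (y :: w') -> reduced_word (rcons w x ++ y :: w').
Proof.
rewrite /reduced_word; case: w => [|z w] /= wx xy yw; first by rewrite xy.
by rewrite cat_path wx last_rcons /= xy.
Qed.

Lemma reduce_word w :
  exists w', reduced_word w' /\ eval_word g w' = eval_word g w.
Proof.
elim: w => [|x w [w' [rw' Ew]]]; first by exists [::].
rewrite eval_word_cons -{}Ew; case: w' rw' => [|y w'] rw'.
  by exists [:: x]; rewrite eval_word_cons.
have [yx|yx] := boolP (compat x y).
  by exists (x :: y :: w'); split; [rewrite /reduced_word /= yx | rewrite eval_word_cons].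
exists w'; split; first exact: reduced_behead rw'.
have -> : y = inv_letter x.
  move: yx; rewrite negbK => /andP[/eqP xy1 xy2]; case: x y xy1 xy2 {rw'} => [i b] [j c] /= ->.
  by case: b; case: c.
by rewrite eval_word_cons eval_letterV mulKVmx ?eval_letter_unit.
Qed.

Lemma mxgroup_words : mxgroup [set eval_word g w | w in setT].
Proof.
split=> [_ [w _ <-]||_ _ [w _ <-] [w' _ <-]|_ [w _ <-]].
- exact: eval_word_unit.
- by exists [::] => //; exact: eval_word0.
- by exists (w ++ w') => //; exact: eval_word_cat.
- by exists (inv_word w) => //; exact: eval_inv_word.
Qed.

(** * The ping-pong lemma for a family of generators *)

Section PingPong.
Variable Y : 'I_r -> set 'cV[F]_n.
Hypothesis ping : forall i j k v, j != i -> k <> 0 -> Y j v ->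
  Y i (mxpowz (g i) k *m v).
Hypothesis Y_disj : forall i j v, i != j -> Y i v -> ~ Y j v.
Hypothesis Y_neq0 : forall i, exists j v, j != i /\ Y j v.

Lemma pingpong_letter x p j v : j != x.1 -> Y j v ->
  Y x.1 (eval_letter x ^+ p.+1 *m v).
Proof.
move=> jx Yv; case: x jx => i b /= ji.
case: b; first by apply: (ping (k := p.+1) ji).
by rewrite /eval_letter exp_invmx //; apply: (ping (k := Negz p) ji).
Qed.

Lemma pingpong_word w x p j v : reduced_word (x :: w) -> j != (last x w).1 ->
  Y j v -> Y x.1 (eval_letter x ^+ p *m eval_word g (x :: w) *m v).
Proof.
elim: w x p => [|y w IH] x p.
  move=> _ /= jx Yv; rewrite eval_word_cons eval_word0 mulmx1.
  by rewrite -[_ *m eval_letter x]/(_ * _) -exprSr; apply: pingpong_letter Yv.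
move=> /[dup] /reduced_behead ryw /= /andP[xy _] jy Yv.
rewrite eval_word_cons mulmxA -[_ *m eval_letter x]/(_ * _) -exprSr.
have := IH y 0%N ryw jy Yv; rewrite expr0 mul1mx => Yy.
have [xy1|xy1] := eqVneq x.1 y.1.
  suff -> : x = y by exact: IH.
  by move: xy; rewrite xy1 eqxx negbK /=; case: x y xy1 {ryw jy IH Yy} => ? ? [? ?] /= -> /eqP ->.
by rewrite -mulmxA; apply: pingpong_letter Yy; rewrite eq_sym.
Qed.

(** When the first and last letters share their generator, a point of another [Y j] is sent into the
    set of that generator, hence moved. *)
Lemma pingpong_neq1 x w : reduced_word (x :: w) -> eval_word g (x :: w) != 1%:M.
Proof.
have same y w' : reduced_word (y :: w') -> (last y w').1 = y.1 ->
    eval_word g (y :: w') != 1%:M.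
  move=> rw yl; apply/eqP => w1; have [j [v [jy Yv]]] := Y_neq0 y.1.
  rewrite -yl in jy; have := pingpong_word 0 rw jy Yv.
  rewrite expr0 mul1mx w1 mul1mx; apply: Y_disj Yv.
  by rewrite -yl.
move=> rw; have [/same|xl] := eqVneq (last x w).1 x.1; first exact.
apply/eqP => w1.
(* Conjugating by [x] reduces to equal end generators; no cancellation occurs, as the last letter of
   the word has another generator. *)
have /same : reduced_word (x :: (x :: w) ++ [:: inv_letter x]).
  have E := lastI x (x :: w); rewrite -cat_cons E; apply: reduced_cat => //.
    rewrite -E; move: rw; rewrite /reduced_word /= => ->.
    by rewrite eqxx /= negbK eqxx.
  by rewrite /= (negbTE xl).
rewrite last_cat /= => /(_ erefl) /eqP; apply.
rewrite eval_word_cons -cat_cons eval_word_cat w1 mul1mx eval_word_cons eval_word0.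
by rewrite mulmx1 eval_letterV mulmxV ?eval_letter_unit.
Qed.

(** Once the first letters differ, the inverse of one word followed by the other is reduced and
    nonempty, so its value is not 1. *)
Lemma reduced_word_inj w w' : reduced_word w -> reduced_word w' ->
  eval_word g w = eval_word g w' -> w = w'.
Proof.
elim: w w' => [|x w IH] [|y w'] // rw rw'.
- by rewrite eval_word0 => /esym/eqP; rewrite (negbTE (pingpong_neq1 rw')).
- by rewrite eval_word0 => /eqP; rewrite (negbTE (pingpong_neq1 rw)).
have [<-|xy] := eqVneq x y.
  rewrite !eval_word_cons => /(congr1 (mulmx (invmx (eval_letter x)))).
  rewrite !mulKmx ?eval_letter_unit // => ww; congr (_ :: _).
  by apply: IH ww; [exact: reduced_behead rw | exact: reduced_behead rw'].
move=> ww.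
have E : eval_word g (inv_word (x :: w) ++ y :: w') = 1%:M.
  by rewrite eval_word_cat eval_inv_word ww mulVmx ?eval_word_unit.
have : reduced_word (inv_word (x :: w) ++ y :: w').
  have := reduced_inv_word rw; rewrite /inv_word /= rev_cons => rwi.
  apply: reduced_cat => //=; apply: contra xy => /andP[/eqP xy1 xy2].
  by case: x y xy1 xy2 {rw rw' ww E rwi} => [? []] [? []] //= ->.
case Ew : (_ ++ _) => [|z s]; first by case: (inv_word _) Ew.
by move/pingpong_neq1; rewrite -Ew E eqxx.
Qed.

Lemma pingpong_free (H : set 'M[F]_n) : mxgroup H -> (forall i, H (g i)) ->
  H `<=` [set eval_word g w | w in setT] -> free_of_rank r H.
Proof.
move=> HG Hg Hw; split=> //; exists g; split=> // A /Hw[w _ <-].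
have [w' [rw' Ew]] := reduce_word w.
exists w'; split=> // w2 [rw2 E2].
by apply: reduced_word_inj; rewrite // E2.
Qed.

End PingPong.
End Words.

(** * The subgroup generated by a(t) and b(s) *)

Lemma mat_a_unit (F : numFieldType) n (t : F) : mat_a n t \in unitmx.
Proof. by have := mat_aD n t (- t); rewrite subrr mat_a0 => /mulmx1_unit[]. Qed.

Lemma mat_b_unit (F : comUnitRingType) n (s : F) : (1 < n)%N ->
  mat_b n s \in unitmx.
Proof. by move=> /(mat_bD s (- s)); rewrite subrr mat_b0 => /mulmx1_unit[]. Qed.

Lemma mxpowz_mat_b (F : comUnitRingType) n (s : F) k : (1 < n)%N ->
  mxpowz (mat_b n s) k = mat_b n (s *~ k).
Proof.
move=> n1.
have bX p : mat_b n s ^+ p = mat_b n (s *+ p).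
  elim: p => [|p IH]; first by rewrite expr0 mulr0n mat_b0.
  by rewrite exprS IH mulrS -mat_bD.
case: k => p; rewrite /mxpowz bX //; apply: mulmx1_invmx.
by rewrite mat_bD // NegzE mulrNz subrr mat_b0.
Qed.

Lemma mxgroup_gen (F : comUnitRingType) n (G : set 'M[F]_n) :
  (forall A, G A -> A \in unitmx) -> mxgroup (mxgen G).
Proof.
move=> uG.
(* This group contains [G], so every matrix in the generated intersection is invertible. *)
have GLG : mxgroup [set A : 'M[F]_n | A \in unitmx].
  split=> //=; first exact: unitmx1.
    by move=> A B uA uB; rewrite unitmx_mul uA.
  by move=> A; rewrite unitmx_inv.
split=> [A HA|K [[]]|A B HA HB K KG|A HA K KG] //.
- by apply: (HA _ (conj GLG uG)).
- by case: (KG) => [[_ _ KM _] _]; apply: KM; [apply: HA | apply: HB].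
- by case: (KG) => [[_ _ _ KV] _]; apply: KV; apply: HA.
Qed.

Section Generators.
Variables (F : numFieldType) (n : nat) (t s : F).
Hypothesis n_gt1 : (1 < n)%N.

Lemma mxgroup_H : mxgroup (H_group n t s).
Proof.
apply: mxgroup_gen => A [->|->]; first exact: mat_a_unit.
exact: mat_b_unit.
Qed.

Lemma H_group_a : H_group n t s (mat_a n t).
Proof. by move=> K [_]; apply; left. Qed.

Lemma H_group_b : H_group n t s (mat_b n s).
Proof. by move=> K [_]; apply; right. Qed.

Lemma H_group_min (K : set 'M[F]_n) : mxgroup K ->
  K (mat_a n t) -> K (mat_b n s) -> H_group n t s `<=` K.
Proof. by move=> KG Ka Kb A; apply; split=> // B [->|->]. Qed.

Lemma dense_of_zstab (G : set 'M[F]_n) : H_group n t s `<=` G ->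
  G `<=` zstab (H_group n t s) -> zariski_dense_subgroup (H_group n t s) G.
Proof.
move=> HG GS; split=> //; first exact: mxgroup_H.
apply: (subset_trans GS); apply: zstab_sub.
by case: mxgroup_H.
Qed.

End Generators.

(** * Ping-pong on [X1] and [X2] *)

Section PingPongSets.
Variables (F : numFieldType) (n : nat).
Hypothesis n_gt0 : (0 < n)%N.
Local Notation N := n.+1.

Lemma ord_max_neq0 : (ord_max : 'I_N) <> ord0.
Proof. by move/(congr1 val) => /= n0; move: n_gt0; rewrite n0. Qed.

Lemma X1P (v : 'cV[F]_N) : X1 F N v <->
  forall j, j <> ord0 -> `|v j 0| < `|v ord0 0|.
Proof.
split=> [H j|H i j i0]; first exact: H.
have -> : i = ord0 by apply: val_inj.
exact: H.
Qed.

Lemma X2P (v : 'cV[F]_N) : X2 F N v <->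
  forall j, j <> ord_max -> `|v j 0| < `|v ord_max 0|.
Proof.
split=> [H j|H i j [i0]]; first exact: H.
have -> : i = ord_max by apply: val_inj.
exact: H.
Qed.

Lemma X1_delta : X1 F N (delta_mx ord0 0).
Proof. by apply/X1P => j /eqP/negbTE j0; rewrite !mxE j0 normr0 normr1 ltr01. Qed.

Lemma X2_delta : X2 F N (delta_mx ord_max 0).
Proof. by apply/X2P => j /eqP/negbTE j0; rewrite !mxE j0 !eqxx normr0 normr1 ltr01. Qed.

Lemma X1_X2_disj (v : 'cV[F]_N) : X1 F N v -> X2 F N v -> False.
Proof.
move=> /X1P/(_ _ ord_max_neq0) v1 /X2P/(_ ord0 (nesym ord_max_neq0)) v2.
by have := lt_trans v1 v2; rewrite ltxx.
Qed.

(** Only the last coordinate changes, and its new modulus is at least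
    [|c| |v_1| - |v_n| > 2 |v_1| - |v_1|]. *)
Lemma mat_b_X1 (c : F) v : 2 < `|c| -> X1 F N v -> X2 F N (mat_b N c *m v).
Proof.
move=> c2 /X1P Xv; apply/X2P => j jmax.
rewrite mat_b_transv transv_mulmx pairing_ed.
have vj : `|v j 0| <= `|v ord0 0|.
  by have [->//|/eqP/Xv/ltW] := eqVneq j ord0.
have vm := Xv _ ord_max_neq0; have vm0 := le_lt_trans (normr_ge0 _) vm.
have -> : (v + v ord0 0 *: (c *: delta_mx ord_max 0)) j 0 = v j 0.
  by rewrite !mxE; move/eqP/negbTE: jmax => ->; rewrite !mulr0 addr0.
have -> : (v + v ord0 0 *: (c *: delta_mx ord_max 0)) ord_max 0 =
    v ord_max 0 + v ord0 0 * c by rewrite !mxE !eqxx mulr1.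
apply: (le_lt_trans vj).
have tri : `|v ord0 0| * `|c| <= `|v ord_max 0 + v ord0 0 * c| + `|v ord_max 0|.
  by rewrite -normrM -{1}[_ * c](addKr (v ord_max 0)) addrC ler_normB.
rewrite -(ltrD2r `|v ord_max 0|); apply: lt_le_trans tri.
apply: (@lt_trans _ _ (`|v ord0 0| * 2)); last by rewrite ltr_pM2l.
by rewrite mulr_natr mulr2n ltrD2l.
Qed.

Lemma H_group_free (t s : F) :
  (forall k v, k <> 0 -> X2 F N v -> X1 F N (mxpowz (mat_a N t) k *m v)) ->
  2 < `|s| -> free_of_rank 2 (H_group N t s).
Proof.
move=> Ha s2.
pose g (i : 'I_2) := if i == 0 then mat_a N t else mat_b N s.
pose Y (i : 'I_2) := if i == 0 then X1 F N else X2 F N.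
have I2 (i : 'I_2) : i = 0 \/ i = 1.
  by case: i => [[|[|[]]]] // i2; [left|right]; apply: val_inj.
have ug i : g i \in unitmx.
  by rewrite /g; case: ifP => _; [exact: mat_a_unit | exact: mat_b_unit].
apply: (@pingpong_free _ _ _ g ug Y).
- move=> i j k v; rewrite /g /Y.
  case: (I2 i) (I2 j) => [-> [->|->]|-> [->|->]] //= _ k0; first exact: Ha.
  rewrite mxpowz_mat_b // => Xv; apply: mat_b_X1 => //.
  (* A nonzero integer has modulus at least 1, so [s *~ k] still exceeds 2 in modulus. *)
  apply: (lt_le_trans s2); rewrite -mulrzr normrM ler_peMr //.
  rewrite -intr_norm ler1z -gtz0_ge1 normr_gt0; exact/eqP.
- move=> i j v; rewrite /Y.
  by case: (I2 i) (I2 j) => [-> [->|->]|-> [->|->]] //= _ H1 H2; apply: (X1_X2_disj (v := v)).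
- move=> i; rewrite /Y; case: (I2 i) => ->.
    by exists 1, (delta_mx ord_max 0); split=> //; exact: X2_delta.
  by exists 0, (delta_mx ord0 0); split=> //; exact: X1_delta.
- exact: mxgroup_H.
- by move=> i; rewrite /g; case: ifP => _; [exact: H_group_a | exact: H_group_b].
apply: H_group_min; first exact: mxgroup_words.
  by exists [:: (0, true)] => //; rewrite eval_word_cons eval_word0 mulmx1.
by exists [:: (1, true)] => //; rewrite eval_word_cons eval_word0 mulmx1.
Qed.

End PingPongSets.

(** For [t = 0] the matrix is the identity, and the last basis vector would lie in both [X1] and
    [X2]. *)
Lemma mat_a_pingpong_neq0 (F : numFieldType) n (t : F) : (0 < n)%N ->
  X1 F n.+1 (mat_a n.+1 t *m delta_mx ord_max 0) -> t != 0.
Proof.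
move=> n0; apply: contraPneq => ->; rewrite mat_a0 mul1mx => X.
exact: (X1_X2_disj n0 X (@X2_delta F n)).
Qed.

(** * Inclusion in the target groups and density *)

Section Density.
Variables (F : numFieldType) (n : nat) (t s : F).
Hypotheses (n_gt0 : (0 < n)%N) (t0 : t != 0) (s0 : s != 0).
Local Notation N := n.+1.
Local Notation K := (zstab (H_group N t s)).

Lemma mxmonoid_zstab_H : mxmonoid K.
Proof. by split; [exact: zstab1 | exact: zstabM]. Qed.

Lemma rootsub_zstab_H u : rootsub K (nu n u) (nud n u).
Proof.
have [_ H1 HM _] := mxgroup_H t s (n_gt0 : (1 < N)%N).
apply: rootsub_nu => // [|x|x]; first exact: mxmonoid_zstab_H.
  by apply: zstab_mat_a t0 HM H1 _; exact: H_group_a.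
by apply: zstab_mat_b s0 HM H1 _ => //; exact: H_group_b.
Qed.

(** It suffices to test on the moment curve, where [a(u)] sends [nu x] to [nu (u + x)] and right
    multiplication by [a(-u)] sends [nud x] to [nud (u + x)]. *)
Lemma symplectic_mat_a u : ~~ odd N -> symplectic (mat_a N u : 'M[F]_N).
Proof.
move=> oN; rewrite /symplectic.
suff H v : sd (mat_a N u *m v) = sd v *m mat_a N (- u).
  suff -> : (mat_a N u)^T *m symp_J F N = symp_J F N *m mat_a N (- u).
    by rewrite -mulmxA mat_aD addNr mat_a0 mulmx1.
  apply/row_matrixP => i; rewrite !rowE -trmx_delta.
  have := H (delta_mx i 0).
  by rewrite /sd trmx_mul !mulmxA.
move: v; apply: nu_ind => [|v c x Hv]; first by rewrite mulmx0 /sd trmx0 !mul0mx.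
rewrite mulmxDr -scalemxAr !sdD !sdZ [RHS]mulmxDl Hv; congr (_ + _).
rewrite -scalemxAl; congr (_ *: _).
rewrite {1}/nu mulmxA mat_aD -/(nu n _) -!nud_sd // /nud.
by rewrite -mulmxA mat_aD addrC opprD.
Qed.

Lemma Sp_dense : ~~ odd N -> zariski_dense_subgroup (H_group N t s) (Spmx F N).
Proof.
move=> oN; apply: dense_of_zstab => //; last first.
  exact: Sp_mem mxmonoid_zstab_H oN rootsub_zstab_H.
apply: H_group_min.
- split.
  + by move=> A [].
  + by apply/SpmxP => //; rewrite /symplectic trmx1 mul1mx mulmx1.
  + by move=> A B /(SpmxP oN) HA /(SpmxP oN) HB; apply/(SpmxP oN)/symplecticM.
  + move=> A [uA AJ]; split; first by rewrite unitmx_inv.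
    rewrite -{1}AJ trmx_inv !mulmxA mulVmx // mul1mx -mulmxA mulmxV ?mulmx1 //.
    by rewrite unitmx_tr.
- by apply/(SpmxP oN)/symplectic_mat_a.
- apply/(SpmxP oN); rewrite mat_b_transv.
  have -> : delta_mx 0 ord0 = sd (delta_mx ord_max 0 : 'cV[F]_N).
    have := @nud_sd F n oN 0; rewrite /nud /nu oppr0 mat_a0 mulmx1 mul1mx.
    exact.
  exact: symplectic_transv.
Qed.

Lemma SL_dense : ~~ odd n -> zariski_dense_subgroup (H_group N t s) (SLmx F N).
Proof.
move=> on; apply: dense_of_zstab => //; last first.
  apply: SL_sub_transv; first exact: mxmonoid_zstab_H.
  exact: transv_mem_odd mxmonoid_zstab_H on rootsub_zstab_H.
apply: H_group_min.
- split=> [A|//|A B|A]; rewrite /SLmx /mkset ?det1 //.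
  + by rewrite unitmxE => ->; exact: unitr1.
  + by rewrite det_mulmx => -> ->; rewrite mulr1.
  + by rewrite det_inv => ->; rewrite invr1.
- rewrite /SLmx /mkset -det_tr det_trig.
    by apply: big1 => i _; rewrite mxE mat_aij leqnn subnn expr0 divr1.
  by apply/is_trig_mxP => i j ij; rewrite mxE mat_aij leqNgt ij.
- rewrite /SLmx /mkset mat_b_transv det_transv //.
  rewrite pairingZr pairing_ed mxE.
  by case: eqP => [/esym/(ord_max_neq0 n_gt0)//|_]; rewrite mulr0.
Qed.

End Density.

Theorem proposition3p8 (R : realType) (m n : nat) (hm : (1 <= m)%N)
    (hn : n = (2 * m)%N \/ n = (2 * m + 1)%N)
    (t0 : R)
    (ht0 : forall t : R[i], (t0%:C)%C < `|t| ->
       forall k : int, k <> 0 ->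
         [set mxpowz (mat_a n t) k *m v | v in X2 R[i] n] `<=` X1 R[i] n)
    (t s : R[i]) (ht : (t0%:C)%C < `|t|) (hs : 2 < `|s|) :
  (n = (2 * m)%N ->
     free_of_rank 2 (H_group n t s) /\
     zariski_dense_subgroup (H_group n t s) (Spmx R[i] n)) /\
  (n = (2 * m + 1)%N ->
     free_of_rank 2 (H_group n t s) /\
     zariski_dense_subgroup (H_group n t s) (SLmx R[i] n)).
Proof.
have n1 : (1 < n)%N by lia.
(* From here on [n] is the dimension minus one, so its parity is opposite to that of the
   dimension. *)
case: n n1 hn ht0 => [//|n] n1 hn ht0.
have Ha k v : k <> 0 -> X2 R[i] n.+1 v -> X1 R[i] n.+1 (mxpowz (mat_a n.+1 t) k *m v).
  by move=> k0 Xv; apply: (ht0 t ht k k0); exists v.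
have free := H_group_free n1 Ha hs.
(* The bound [t0] may be negative, so this comes from the ping-pong hypothesis with [k = 1]. *)
have tn0 : t != 0.
  by apply: (mat_a_pingpong_neq0 n1); apply: (Ha 1) => //; exact: X2_delta.
have sn0 : s != 0 by rewrite -normr_gt0 (lt_trans _ hs).
split=> nE; split=> //.
  by apply: Sp_dense => //; rewrite nE mul2n odd_double.
apply: SL_dense => //; have -> : n = (2 * m)%N by lia.
by rewrite mul2n odd_double.
Qed.
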